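(* The third-order ordinary differential equation $$v'''=-3\left(v^2-v'\right)v'+\frac{3}{2}v^4-\frac{\left(v^3-2v''\right)\left(5v^3+2v''\right)}{2\left(v^2+2v'\right)}$$ admits meromorphic solutions near $t=t_0$ with the Laurent expansions $$v_1(t)=\frac{-1}{t-t_0}+a_1+a_2(t-t_0)+\frac{a_1(a_1^2+a_2)}{2}(t-t_0)^2+\cdots,$$ $$v_2(t)=\frac{-2}{t-t_0}+a_1(t-t_0)^2+\frac{2}{21}a_1^2(t-t_0)^5+\cdots,$$ $$v_3(t)=\frac{1}{t-t_0},$$ where $t_0\in\mathbb{C}$ is arbitrary, $a_1,a_2\in\mathbb{C}$ are free parameters in $v_1$, and $a_1\in\mathbb{C}$ is a free parameter in $v_2$.
   Context: Primes denote derivatives with respect to the complex variable $t$. In the displayed expansions ''$\cdots$'' stands for terms of strictly higher order in $(t-t_0)$ than those displayed, and any power of $(t-t_0)$ below the last displayed one that is not written has coefficient zero. *)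

(* Defs.v *)
From Stdlib Require Export Reals ZArith.
From Coquelicot Require Export Coquelicot.

Local Open Scope C_scope.

Definition punctured_disc (t0 : C) (r : R) (t : C) : Prop :=
  (0 < Cmod (t - t0) < r)%R.

(* [C_derive] and [/] are total functions in Coquelicot.  The existence of the
   three complex derivatives and the non-vanishing of the denominator, which
   are part of the meaning of the equation, are therefore required here. *)
Definition satisfies_ode_at (v : C -> C) (t : C) : Prop :=
  let v1 := C_derive v in
  let v2 := C_derive v1 in
  let v3 := C_derive v2 in
  ex_derive v t /\ ex_derive v1 t /\ ex_derive v2 t /\
  v t ^ 2 + 2 * v1 t <> 0 /\
  v3 t = - 3 * (v t ^ 2 - v1 t) * v1 t + 3 / 2 * v t ^ 4
         - (v t ^ 3 - 2 * v2 t) * (5 * v t ^ 3 + 2 * v2 t)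
           / (2 * (v t ^ 2 + 2 * v1 t)).

Definition meromorphic_at (v : C -> C) (t0 : C) : Prop :=
  exists (N : nat) (r : R) (g : C -> C),
    (0 < r)%R /\
    (forall t : C, (Cmod (t - t0) < r)%R -> ex_derive g t) /\
    (forall t : C, punctured_disc t0 r t -> v t = g t / (t - t0) ^ N).

Definition meromorphic_solution_near (v : C -> C) (t0 : C) : Prop :=
  meromorphic_at v t0 /\
  exists r : R, (0 < r)%R /\
    forall t : C, punctured_disc t0 r t -> satisfies_ode_at v t.

(* [c k] is the coefficient of (t - t0)^k; the regular part and the principal
   part each have to converge. *)
Definition laurent_expansion_at (v : C -> C) (t0 : C) (c : Z -> C) : Prop :=
  exists r : R, (0 < r)%R /\
    forall t : C, punctured_disc t0 r t ->
      exists reg princ : C,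
        is_series (fun n : nat => c (Z.of_nat n) * (t - t0) ^ n) reg /\
        is_series (fun n : nat => c (- Z.of_nat (S n))%Z / (t - t0) ^ S n)
          princ /\
        v t = reg + princ.

(* Main.v *)
Require Import Defs.
From Stdlib Require Import Reals ZArith.
From Coquelicot Require Import Coquelicot.
From Stdlib Require Import Lra Lia.
Local Open Scope C_scope.

(** Put [h = v + 2 v' / v], [y = - h - 2 h' / h] and [q = v^2 / h].  In these
    variables the equation is a homogeneous quadratic system,
<<
  v' = v (h - v) / 2,   h' = - h (h + y) / 2,
  y' = 27/2 v^2 - 9/2 v h - v y + 6 q y,   q h = v^2,
>>
    and its denominator [v^2 + 2 v'] is [v h] ([ode_of_system]).  The solution
    [1 / (t - t0)] corresponds to constant multiples of [1 / (t - t0)] in all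
    four variables.

    For the other two families write [s = t - t0] and multiply the four
    functions by [s].  The system becomes one of Briot-Bouquet type: in order
    [n] the coefficients of a power series solution satisfy a linear system
    whose right-hand side is a quadratic convolution of the coefficients of
    lower order ([solves], [linearized]).  Its determinant is a multiple of
    [(n + 1) (n - 1) (n - 2)] for residue [-1] and of
    [(n + 1) (n + 2) (n - 3)] for residue [-2].  At the positive roots the
    system is consistent and leaves a coefficient free: these are the
    parameters of the two expansions.  Beyond them the system has an inverse
    bounded uniformly in [n], so the norms [b n] of the coefficients satisfy
    [b n <= K * sum_k b k * b (n - k)], and the sequence [1 / n^2], which is
    stable under convolution, yields geometric growth ([quadratic_majorant],
    [formal_solution]).

    The resulting power series converge near [0].  Termwise differentiation
    ([is_derive_power_sum]) and Cauchy products turn the relations between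
    coefficients into the quadratic system for the sums, and division by [s]
    gives the solutions of the equation ([meromorphic_solution_quotient]). *)

(** * Complex derivatives and reduction of the equation *)

(** Sums in Coquelicot are stated in the carrier of an algebraic structure;
    [ring] and [field] need the equation at type [C]. *)
Ltac C_eq := match goal with |- ?a = ?b => change (@eq C a b) end.

(** The two normed-module structures on the complex numbers have the same
    scalar action and the same norm, but different uniform structures, so the
    product rule of one has to be carried over to the other. *)
Lemma is_derive_C_AbsRing (f : C -> C) (z l : C) :
  is_derive (K := C_AbsRing) (V := AbsRing_NormedModule C_AbsRing) f z l <->
  is_derive (K := C_AbsRing) (V := C_NormedModule) f z l.
Proof.
split; intros [_ H]; (split; [apply is_linear_scal_l | exact H]).
Qed.

Lemma is_derive_C_mult (f g : C -> C) (z df dg : C) :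
  is_derive f z df -> is_derive g z dg ->
  is_derive (fun t => f t * g t) z (df * g z + f z * dg).
Proof.
intros Hf Hg; apply is_derive_C_AbsRing in Hf; apply is_derive_C_AbsRing in Hg.
apply is_derive_C_AbsRing.
exact (is_derive_mult (K := C_AbsRing) f g z df dg Hf Hg Cmult_comm).
Qed.

Lemma is_derive_C_plus (f g : C -> C) (z df dg : C) :
  is_derive f z df -> is_derive g z dg -> is_derive (fun t => f t + g t) z (df + dg).
Proof. exact (is_derive_plus (K := C_AbsRing) (V := C_NormedModule) f g z df dg). Qed.

Lemma is_derive_C_minus (f g : C -> C) (z df dg : C) :
  is_derive f z df -> is_derive g z dg -> is_derive (fun t => f t - g t) z (df - dg).
Proof. exact (is_derive_minus (K := C_AbsRing) (V := C_NormedModule) f g z df dg). Qed.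

Lemma is_derive_C_const (c z : C) : is_derive (fun _ : C => c) z (RtoC 0).
Proof. exact (is_derive_const (K := C_AbsRing) (V := C_NormedModule) c z). Qed.

Lemma is_derive_C_eq (f : C -> C) (z l l' : C) :
  is_derive f z l -> l = l' -> is_derive f z l'.
Proof. intros H <-; exact H. Qed.

Lemma is_derive_C_comp (f g : C -> C) (z df dg : C) :
  is_derive f (g z) df -> is_derive g z dg ->
  is_derive (fun t => f (g t)) z (dg * df).
Proof.
intros Hf Hg; apply is_derive_C_AbsRing in Hg.
exact (is_derive_comp (K := C_AbsRing) (V := C_NormedModule) f g z df dg Hf Hg).
Qed.

(** A quadratic error bound settles differentiability both for the inverse
    function and for sums of power series. *)
Lemma is_derive_quadratic_error (f : C -> C) (z l : C) (r B : R) :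
  (0 < r)%R ->
  (forall y, (Cmod (y - z) < r)%R ->
     (Cmod (f y - f z - (y - z) * l) <= B * Cmod (y - z) ^ 2)%R) ->
  is_derive f z l.
Proof.
intros Hr HB; split.
  apply is_linear_scal_l.
intros x Hx eps.
assert (E : z = x) by exact (is_filter_lim_locally_unique (V := AbsRing_NormedModule C_AbsRing) _ _ Hx).
subst x.
assert (Hd : (0 < Rmin r (eps / (Rabs B + 1)))%R).
{ apply Rmin_glb_lt; [assumption|].
  apply Rdiv_lt_0_compat; [apply cond_pos | pose proof (Rabs_pos B); lra]. }
exists (mkposreal _ Hd); intros y Hy.
assert (Hy' : (Cmod (y - z) < Rmin r (eps / (Rabs B + 1)))%R) by exact Hy.
change (Cmod (f y - f z - (y - z) * l) <= eps * Cmod (y - z))%R.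
assert (H1 : (Cmod (y - z) < r)%R) by (eapply Rlt_le_trans; [exact Hy' | apply Rmin_l]).
assert (H2 : (Cmod (y - z) < eps / (Rabs B + 1))%R) by (eapply Rlt_le_trans; [exact Hy' | apply Rmin_r]).
eapply Rle_trans; [apply HB; exact H1|].
pose proof (Rabs_pos B); pose proof (Cmod_ge_0 (y - z)); pose proof (Rle_abs B).
assert (Hlt : (Cmod (y - z) * (Rabs B + 1) < eps)%R).
{ apply (Rmult_lt_compat_r (Rabs B + 1)) in H2; [|lra].
  replace (eps / (Rabs B + 1) * (Rabs B + 1))%R with (pos eps) in H2 by (field; lra).
  exact H2. }
set (d := Cmod (y - z)) in *.
replace (B * d ^ 2)%R with ((B * d) * d)%R by ring.
apply Rmult_le_compat_r; [assumption|].
nra.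
Qed.

Lemma is_derive_C_inv (z : C) : z <> 0 -> is_derive (fun t : C => / t) z (- / (z * z)).
Proof.
intros Hz.
assert (Hm : (0 < Cmod z)%R) by (apply Cmod_gt_0; assumption).
apply (is_derive_quadratic_error _ _ _ (Cmod z / 2) (2 / Cmod z ^ 3)); [lra|].
intros y Hy.
assert (Hy2 : (Cmod z / 2 <= Cmod y)%R).
{ pose proof (Cmod_triangle (z - y) y) as T.
  replace (z - y + y) with z in T by ring.
  replace (z - y) with (- (y - z)) in T by ring.
  rewrite Cmod_opp in T. lra. }
assert (Hy0 : y <> 0) by (apply Cmod_gt_0; lra).
replace (/ y - / z - (y - z) * - / (z * z)) with ((y - z) ^ 2 / (z ^ 2 * y)).
2:{ field; split; assumption. }
rewrite Cmod_div, Cmod_mult, !Cmod_pow.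
2:{ apply Cmult_neq_0; [apply Cpow_nz|]; assumption. }
set (d := Cmod (y - z)) in *.
assert (0 <= d)%R by apply Cmod_ge_0.
unfold Rdiv. rewrite (Rmult_comm (d ^ 2)).
apply Rmult_le_compat_r; [apply pow2_ge_0|].
replace (2 * / Cmod z ^ 3)%R with (/ (Cmod z ^ 2 * (Cmod z / 2)))%R by (field; lra).
apply Rinv_le_contravar.
- apply Rmult_lt_0_compat; [apply pow_lt; assumption | lra].
- apply Rmult_le_compat_l; [apply pow2_ge_0 | assumption].
Qed.

(** [C_derive v] is only known on an open set, so the iterated derivatives in
    the equation are computed by passing to a function that agrees there. *)
Lemma is_C_derive_ext_open (U : C -> Prop) (f g : C -> C) (z l : C) :
  (forall t, U t -> exists r : R, (0 < r)%R /\ forall y, (Cmod (y - t) < r)%R -> U y) ->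
  (forall t, U t -> f t = g t) -> U z ->
  is_derive f z l -> is_derive g z l.
Proof.
intros HU Hfg Hz Hf.
destruct (HU z Hz) as [r [Hr HB]].
apply (is_derive_ext_loc (K := C_AbsRing) (V := C_NormedModule) f g); [|exact Hf].
exists (mkposreal r Hr); intros y Hy.
apply Hfg, HB. exact Hy.
Qed.

(** With [h = v + 2 v' / v] the denominator [v^2 + 2 v'] is the product [v h],
    and with [y = - h - 2 h' / h] the third-order equation says exactly that
    [y'] has the value below.  The three right-hand sides give [v''] and [v''']
    as rational functions of [v], [h], [y], and the equation becomes an
    identity between these. *)
Lemma ode_of_system (U : C -> Prop) (v h y : C -> C) :
  (forall t, U t -> exists r : R, (0 < r)%R /\ forall w, (Cmod (w - t) < r)%R -> U w) ->
  (forall t, U t -> v t <> 0 /\ h t <> 0) ->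
  (forall t, U t -> is_derive v t (v t * (h t - v t) / 2)) ->
  (forall t, U t -> is_derive h t (- (h t * (h t + y t)) / 2)) ->
  (forall t, U t -> is_derive y t
     (27 / 2 * v t ^ 2 - 9 / 2 * (v t * h t) - v t * y t + 6 * (v t ^ 2 / h t * y t))) ->
  forall t, U t -> satisfies_ode_at v t.
Proof.
intros HU Hnz Hv Hh Hy.
set (v1 := fun t => v t * (h t - v t) / 2).
set (h1 := fun t => - (h t * (h t + y t)) / 2).
set (v2 := fun t => (v1 t * (h t - v t) + v t * (h1 t - v1 t)) / 2).
set (y1 := fun t => 27 / 2 * v t ^ 2 - 9 / 2 * (v t * h t) - v t * y t + 6 * (v t ^ 2 / h t * y t)).
set (h2 := fun t => - (h1 t * (h t + y t) + h t * (h1 t + y1 t)) / 2).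
set (v3 := fun t => (v2 t * (h t - v t) + 2 * (v1 t * (h1 t - v1 t)) + v t * (h2 t - v2 t)) / 2).
assert (D1 : forall t, U t -> C_derive v t = v1 t).
{ intros t Ht. apply is_C_derive_unique, Hv, Ht. }
assert (V1 : forall t, U t -> is_derive v1 t (v2 t)).
{ intros t Ht. eapply is_derive_C_eq.
  - apply is_derive_C_mult; [apply is_derive_C_mult; [apply Hv, Ht|apply is_derive_C_minus; [apply Hh, Ht|apply Hv, Ht]]|apply (is_derive_C_const (/ 2))].
  - fold (v1 t) (h1 t). unfold v2. field. }
assert (H1 : forall t, U t -> is_derive h1 t (h2 t)).
{ intros t Ht. eapply is_derive_C_eq.
  - apply (is_C_derive_ext_open U (fun t => h t * (h t + y t) * (- / 2))); [exact HU| |exact Ht|].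
    + intros x _; unfold h1; field.
    + apply is_derive_C_mult; [apply is_derive_C_mult; [apply Hh, Ht|apply is_derive_C_plus; [apply Hh, Ht|apply Hy, Ht]]|apply is_derive_C_const].
  - fold (y1 t) (h1 t). unfold h2. field. }
assert (V2 : forall t, U t -> is_derive v2 t (v3 t)).
{ intros t Ht. eapply is_derive_C_eq.
  - apply is_derive_C_mult; [apply is_derive_C_plus; apply is_derive_C_mult|apply (is_derive_C_const (/ 2))].
    + apply V1, Ht.
    + apply is_derive_C_minus; [apply Hh, Ht|apply Hv, Ht].
    + apply Hv, Ht.
    + apply is_derive_C_minus; [apply H1, Ht|apply V1, Ht].
  - fold (v1 t) (h1 t). unfold v3. field. }
assert (W1 : forall t, U t -> is_derive (C_derive v) t (v2 t)).
{ intros t Ht. apply (is_C_derive_ext_open U v1); [exact HU| |exact Ht|apply V1, Ht].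
  intros x Hx; symmetry; apply D1, Hx. }
assert (D2 : forall t, U t -> C_derive (C_derive v) t = v2 t).
{ intros t Ht. apply is_C_derive_unique, W1, Ht. }
assert (W2 : forall t, U t -> is_derive (C_derive (C_derive v)) t (v3 t)).
{ intros t Ht. apply (is_C_derive_ext_open U v2); [exact HU| |exact Ht|apply V2, Ht].
  intros x Hx; symmetry; apply D2, Hx. }
intros t Ht. destruct (Hnz t Ht) as [nv nh].
assert (Dn : v t ^ 2 + 2 * v1 t = v t * h t) by (unfold v1; field).
unfold satisfies_ode_at. rewrite (D1 t Ht), (D2 t Ht), Dn.
repeat split.
- exists (v1 t). apply Hv, Ht.
- exists (v2 t). apply W1, Ht.
- exists (v3 t). apply W2, Ht.
- apply Cmult_neq_0; assumption.
- rewrite (is_C_derive_unique _ _ _ (W2 t Ht)).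
  unfold v3, v2, h2, y1, v1, h1. field. split; assumption.
Qed.

(** * Complex power series *)

Lemma sum_n_C_parts (a : nat -> C) (n : nat) :
  sum_n a n = (sum_n (fun k => Re (a k)) n, sum_n (fun k => Im (a k)) n).
Proof.
induction n as [|n IH].
- rewrite !sum_O. apply surjective_pairing.
- rewrite !sum_Sn, IH. reflexivity.
Qed.

Lemma is_series_C_parts (a : nat -> C) (l : C) :
  is_series a l <->
  is_series (fun n => Re (a n)) (Re l) /\ is_series (fun n => Im (a n)) (Im l).
Proof.
split.
- intros H. pose proof (proj1 (filterlim_locally (U := C_UniformSpace) _ _) H) as Hb.
  split; apply (filterlim_locally (U := R_UniformSpace)); intros eps;
    generalize (Hb eps); apply filter_imp; intros n Hn;
    rewrite sum_n_C_parts in Hn; apply Hn.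
- intros [H1 H2]. apply (filterlim_locally (U := C_UniformSpace)). intros eps.
  pose proof (proj1 (filterlim_locally _ _) H1 eps) as E1.
  pose proof (proj1 (filterlim_locally _ _) H2 eps) as E2.
  generalize (filter_and _ _ E1 E2). apply filter_imp. intros n [B1 B2].
  rewrite sum_n_C_parts. split; assumption.
Qed.

Lemma is_series_C_unique (a : nat -> C) (l l' : C) :
  is_series a l -> is_series a l' -> l = l'.
Proof.
intros H H'. exact (filterlim_locally_unique (V := C_NormedModule) _ _ _ H H').
Qed.

Lemma Cmod_sum_n_le (a : nat -> C) (b : nat -> R) (n : nat) :
  (forall k, (k <= n)%nat -> (Cmod (a k) <= b k)%R) ->
  (Cmod (sum_n a n) <= sum_n b n)%R.
Proof.
induction n as [|n IH]; intros H.
- rewrite !sum_O. apply H; lia.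
- rewrite !sum_Sn. eapply Rle_trans; [apply Cmod_triangle|].
  apply Rplus_le_compat; [apply IH; intros k Hk; apply H; lia|apply H; lia].
Qed.

Lemma Cmod_series_le (a : nat -> C) (b : nat -> R) (l : C) (B : R) :
  is_series a l -> is_series b B -> (forall n, (Cmod (a n) <= b n)%R) -> (Cmod l <= B)%R.
Proof.
intros Ha Hb Hab.
assert (Hn : is_lim_seq (fun n => Cmod (sum_n a n)) (Cmod l)).
{ exact (filterlim_comp _ _ _ _ _ _ _ _ Ha (filterlim_norm (V := C_NormedModule) l)). }
assert (Hb' : is_lim_seq (sum_n b) B) by exact Hb.
refine (is_lim_seq_le _ _ (Cmod l) B _ Hn Hb').
intros n. apply Cmod_sum_n_le. auto.
Qed.

Definition Cauchy_product (a b : nat -> C) (n : nat) : C :=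
  sum_n (fun k => a k * b (n - k)%nat) n.

(** The real and imaginary parts of the product are combinations of four real
    Cauchy products. *)
Lemma is_series_Cauchy_product (a b : nat -> C) (la lb : C) :
  is_series a la -> is_series b lb ->
  ex_series (fun n => Cmod (a n)) -> ex_series (fun n => Cmod (b n)) ->
  is_series (Cauchy_product a b) (la * lb).
Proof.
intros Ha Hb Aa Ab.
apply is_series_C_parts in Ha; apply is_series_C_parts in Hb.
destruct Ha as [Ha1 Ha2], Hb as [Hb1 Hb2].
assert (abs_re : forall c : nat -> C, ex_series (fun n => Cmod (c n)) ->
  ex_series (fun n => Rabs (Re (c n)))).
{ intros c Hc. apply (ex_series_le (V := R_CompleteNormedModule) _ (fun n => Cmod (c n))); [|exact Hc].
  intros n. change (Rabs (Rabs (Re (c n))) <= Cmod (c n))%R. rewrite Rabs_Rabsolu.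
  eapply Rle_trans; [apply Rmax_l|apply Rmax_Cmod]. }
assert (abs_im : forall c : nat -> C, ex_series (fun n => Cmod (c n)) ->
  ex_series (fun n => Rabs (Im (c n)))).
{ intros c Hc. apply (ex_series_le (V := R_CompleteNormedModule) _ (fun n => Cmod (c n))); [|exact Hc].
  intros n. change (Rabs (Rabs (Im (c n))) <= Cmod (c n))%R. rewrite Rabs_Rabsolu.
  eapply Rle_trans; [apply Rmax_r|apply Rmax_Cmod]. }
pose proof (is_series_mult _ _ _ _ Ha1 Hb1 (abs_re _ Aa) (abs_re _ Ab)) as RR.
pose proof (is_series_mult _ _ _ _ Ha2 Hb2 (abs_im _ Aa) (abs_im _ Ab)) as II.
pose proof (is_series_mult _ _ _ _ Ha1 Hb2 (abs_re _ Aa) (abs_im _ Ab)) as RI.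
pose proof (is_series_mult _ _ _ _ Ha2 Hb1 (abs_im _ Aa) (abs_re _ Ab)) as IR.
apply is_series_C_parts; split.
- eapply is_series_ext; [|exact (is_series_minus _ _ _ _ RR II)].
  intros n. unfold Cauchy_product. rewrite sum_n_C_parts. rewrite <- !sum_n_Reals.
  assert (E : forall m, (sum_n (fun k => Re (a k) * Re (b (n - k)%nat)) m
    - sum_n (fun k => Im (a k) * Im (b (n - k)%nat)) m
    = sum_n (fun k => Re (a k * b (n - k)%nat)%C) m)%R); [|exact (E n)].
  induction m as [|m IH].
  + rewrite !sum_O. reflexivity.
  + rewrite !sum_Sn, <- IH. cbn -[sum_n Nat.sub]. unfold Re, Im. ring.
- eapply is_series_ext; [|exact (is_series_plus _ _ _ _ RI IR)].
  intros n. unfold Cauchy_product. rewrite sum_n_C_parts. rewrite <- !sum_n_Reals.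
  assert (E : forall m, (sum_n (fun k => Re (a k) * Im (b (n - k)%nat)) m
    + sum_n (fun k => Im (a k) * Re (b (n - k)%nat)) m
    = sum_n (fun k => Im (a k * b (n - k)%nat)%C) m)%R); [|exact (E n)].
  induction m as [|m IH].
  + rewrite !sum_O. reflexivity.
  + rewrite !sum_Sn, <- IH. cbn -[sum_n Nat.sub]. unfold Re, Im. ring.
Qed.

Definition geometric (R0 : R) (a : nat -> C) : Prop :=
  exists M : R, forall n, (Cmod (a n) * R0 ^ n <= M)%R.

(** [iota] picks the sum where the series converges, so that the sum is a total
    function of [s]. *)
Definition power_sum (a : nat -> C) (s : C) : C :=
  iota (T := C_CompleteNormedModule) (fun l => is_series (V := C_NormedModule) (fun n => a n * s ^ n) l).

(** The disc is taken four times smaller than the growth condition allows: the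
    terms are then dominated by [4^-n], which leaves room for the factor [n^2]
    needed when differentiating. *)
Lemma geometric_term (R0 M : R) (a : nat -> C) (s : C) (n : nat) :
  (0 < R0)%R -> (Cmod (a n) * R0 ^ n <= M)%R -> (Cmod s <= R0 / 4)%R ->
  (Cmod (a n * s ^ n) <= M * (/ 4) ^ n)%R.
Proof.
intros HR HM Hs. rewrite Cmod_mult, Cmod_pow.
apply Rle_trans with (Cmod (a n) * (R0 / 4) ^ n)%R.
- apply Rmult_le_compat_l; [apply Cmod_ge_0|]. apply pow_incr; split; [apply Cmod_ge_0|exact Hs].
- unfold Rdiv. rewrite Rpow_mult_distr, <- Rmult_assoc.
  apply Rmult_le_compat_r; [apply pow_le; lra|exact HM].
Qed.

Lemma ex_series_geometric_terms (R0 : R) (a : nat -> C) (s : C) :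
  (0 < R0)%R -> geometric R0 a -> (Cmod s <= R0 / 4)%R ->
  ex_series (fun n => Cmod (a n * s ^ n)).
Proof.
intros HR [M HM] Hs.
apply (ex_series_le (V := R_CompleteNormedModule) _ (fun n => scal M ((/ 4) ^ n)%R)).
- intros n. change (Rabs (Cmod (a n * s ^ n)) <= M * (/4) ^ n)%R.
  rewrite Rabs_pos_eq by apply Cmod_ge_0. now apply (geometric_term R0).
- apply (ex_series_scal (V := R_NormedModule)). exists (/ (1 - / 4))%R. apply is_series_geom.
  rewrite Rabs_pos_eq; lra.
Qed.

Lemma power_sum_correct (R0 : R) (a : nat -> C) (s : C) :
  (0 < R0)%R -> geometric R0 a -> (Cmod s <= R0 / 4)%R ->
  is_series (fun n => a n * s ^ n) (power_sum a s).
Proof.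
intros HR Ha Hs.
assert (E : ex_series (V := C_NormedModule) (fun n => a n * s ^ n)).
{ apply (ex_series_le (V := C_CompleteNormedModule) _ (fun n => Cmod (a n * s ^ n))).
  - intros n. apply Rle_refl.
  - now apply (ex_series_geometric_terms R0). }
destruct E as [l Hl].
replace (power_sum a s) with l; [exact Hl|].
symmetry. exact (iota_filterlim_locally (V := C_CompleteNormedModule) (F := eventually) _ _ Hl).
Qed.

Lemma power_sum_mult (R0 : R) (a b : nat -> C) (s : C) :
  (0 < R0)%R -> geometric R0 a -> geometric R0 b -> (Cmod s <= R0 / 4)%R ->
  is_series (fun n => Cauchy_product a b n * s ^ n) (power_sum a s * power_sum b s).
Proof.
intros HR Ha Hb Hs.
eapply is_series_ext; [|apply is_series_Cauchy_product].
2-3: apply (power_sum_correct R0); assumption.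
2-3: apply (ex_series_geometric_terms R0); assumption.
intros n. unfold Cauchy_product.
transitivity (sum_n (fun k => mult (a k * b (n - k)%nat) (s ^ n)) n).
- apply sum_n_ext_loc. intros k Hk. unfold mult; simpl.
  assert (E : s ^ n = s ^ k * s ^ (n - k)) by (rewrite <- Cpow_add_r; f_equal; lia).
  rewrite E.
  change ((a k * s ^ k) * (b (n - k)%nat * s ^ (n - k)) = a k * b (n - k)%nat * (s ^ k * s ^ (n - k))). ring.
- rewrite sum_n_mult_r. reflexivity.
Qed.

(** Induction on [n]: if [e] is the error at [n], the error at [n + 1] is
    [y e + n z^(n-1) (y - z)^2].  The factor [r^2] on the left avoids the
    exponent [n - 2]. *)
Lemma pow_first_order_error (r : R) (y z : C) (n : nat) :
  (0 < r)%R -> (Cmod y <= r)%R -> (Cmod z <= r)%R ->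
  (Cmod (y ^ n - z ^ n - (y - z) * (INR n * z ^ pred n)) * r ^ 2
    <= INR n ^ 2 * r ^ n * Cmod (y - z) ^ 2)%R.
Proof.
intros Hr Hy Hz. set (d := Cmod (y - z)).
assert (Hd : (0 <= d)%R) by apply Cmod_ge_0.
induction n as [|n IH].
- replace (y ^ 0 - z ^ 0 - (y - z) * (INR 0 * z ^ pred 0)) with (RtoC 0) by (simpl; ring).
  rewrite Cmod_0. simpl. lra.
- set (e := y ^ n - z ^ n - (y - z) * (INR n * z ^ pred n)) in *.
  assert (Hsplit : y ^ S n - z ^ S n - (y - z) * (INR (S n) * z ^ pred (S n))
     = y * e + INR n * z ^ pred n * (y - z) ^ 2).
  { unfold e. rewrite S_INR, RtoC_plus. destruct n as [|n]; simpl; ring. }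
  rewrite Hsplit.
  assert (Hz' : (Cmod (INR n * z ^ pred n * (y - z) ^ 2) * r ^ 2 <= INR n * (r ^ S n * d ^ 2))%R).
  { rewrite !Cmod_mult, !Cmod_pow, Cmod_R, (Rabs_pos_eq _ (pos_INR n)). fold d.
    destruct n as [|n]; [simpl; lra|]. simpl pred.
    replace (INR (S n) * Cmod z ^ n * d ^ 2 * r ^ 2)%R with (INR (S n) * (Cmod z ^ n * (d ^ 2 * r ^ 2)))%R by ring.
    replace (r ^ S (S n) * d ^ 2)%R with (r ^ n * (d ^ 2 * r ^ 2))%R by (simpl; ring).
    apply Rmult_le_compat_l; [apply pos_INR|].
    apply Rmult_le_compat_r; [apply Rmult_le_pos; apply pow2_ge_0|].
    apply pow_incr; split; [apply Cmod_ge_0|exact Hz]. }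
  eapply Rle_trans.
  { apply Rmult_le_compat_r; [apply pow2_ge_0|apply Cmod_triangle]. }
  rewrite Rmult_plus_distr_r, Cmod_mult.
  assert (He : (Cmod y * Cmod e * r ^ 2 <= r * (INR n ^ 2 * r ^ n * d ^ 2))%R).
  { rewrite Rmult_assoc. apply Rmult_le_compat; try assumption.
    - apply Cmod_ge_0.
    - apply Rmult_le_pos; [apply Cmod_ge_0|apply pow2_ge_0]. }
  rewrite S_INR. pose proof (pos_INR n).
  assert (0 <= r ^ S n * d ^ 2)%R by (apply Rmult_le_pos; [apply pow_le; lra|apply pow2_ge_0]).
  replace (r * (INR n ^ 2 * r ^ n * d ^ 2))%R with (INR n ^ 2 * (r ^ S n * d ^ 2))%R in He by (simpl; ring).
  nra.
Qed.

Lemma sqr_le_pow2 (n : nat) : (INR n ^ 2 <= 2 * 2 ^ n)%R.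
Proof.
(* The second bound makes the induction go through. *)
assert (H : (INR n ^ 2 <= 2 * 2 ^ n /\ 2 * INR n + 1 <= 2 * 2 ^ n + 1)%R).
{ induction n as [|n [IH1 IH2]]; [simpl; lra|].
  destruct n as [|[|[|n]]]; [simpl; lra|simpl; lra|simpl; lra|].
  set (m := S (S (S n))) in *. rewrite S_INR. simpl pow.
  assert (3 <= INR m)%R. { unfold m. rewrite !S_INR. pose proof (pos_INR n). lra. }
  simpl pow in *. split; nra. }
tauto.
Qed.

(** The derivative enters only through [z] times it, whose series has the
    coefficients [n a_n] and needs no shift of indices. *)
Lemma is_derive_power_sum (R0 : R) (a : nat -> C) (z : C) :
  (0 < R0)%R -> geometric R0 a -> (Cmod z < R0 / 4)%R ->
  exists l : C, is_derive (power_sum a) z l /\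
    is_series (fun n => INR n * a n * z ^ n) (z * l).
Proof.
intros HR [M HM] Hz.
assert (Hr : (0 < R0 / 4)%R) by lra. set (r := (R0 / 4)%R) in *.
assert (Hgeom : is_series (fun n => 2 * M * (/ 2) ^ n)%R (2 * M * / (1 - / 2))%R).
{ apply (is_series_scal (V := R_NormedModule) (2 * M)%R (fun n => ((/ 2) ^ n)%R)), is_series_geom.
  rewrite Rabs_pos_eq; lra. }
assert (HM0 : (0 <= M)%R).
{ eapply Rle_trans; [|apply (HM 0%nat)]. apply Rmult_le_pos; [apply Cmod_ge_0|apply pow_le; lra]. }
assert (Hbase : forall n, (Cmod (a n) * r ^ n * INR n ^ 2 <= 2 * M * (/ 2) ^ n)%R).
{ intros n. unfold r, Rdiv. rewrite Rpow_mult_distr.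
  replace (/ 4)%R with (/ 2 * / 2)%R by lra. rewrite Rpow_mult_distr.
  assert (P : (0 < (/ 2) ^ n)%R) by (apply pow_lt; lra).
  assert (Q : ((/ 2) ^ n * INR n ^ 2 <= 2)%R).
  { pose proof (sqr_le_pow2 n). rewrite pow_inv.
    apply (Rmult_le_reg_l (2 ^ n)); [apply pow_lt; lra|].
    rewrite <- Rmult_assoc, Rinv_r by (apply pow_nonzero; lra). lra. }
  replace (Cmod (a n) * (R0 ^ n * ((/ 2) ^ n * (/ 2) ^ n)) * INR n ^ 2)%R
    with ((Cmod (a n) * R0 ^ n) * ((/ 2) ^ n * INR n ^ 2) * (/ 2) ^ n)%R by ring.
  apply Rmult_le_compat_r; [lra|]. rewrite (Rmult_comm 2 M).
  apply Rmult_le_compat; [| |apply HM|exact Q].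
  - apply Rmult_le_pos; [apply Cmod_ge_0|apply pow_le; lra].
  - apply Rmult_le_pos; [lra|apply pow2_ge_0]. }
assert (El : ex_series (V := C_NormedModule) (fun n => INR n * a n * z ^ pred n)).
{ apply (ex_series_le (V := C_CompleteNormedModule) _ (fun n => 2 * M * (/ 2) ^ n * / r)%R).
  - intros n. change (Cmod (INR n * a n * z ^ pred n) <= 2 * M * (/ 2) ^ n * / r)%R.
    apply (Rmult_le_reg_r r); [exact Hr|]. rewrite (Rmult_assoc _ (/ r)), Rinv_l, Rmult_1_r by lra.
    eapply Rle_trans; [|apply Hbase].
    rewrite !Cmod_mult, Cmod_pow, Cmod_R, (Rabs_pos_eq _ (pos_INR n)).
    destruct n as [|n]; [simpl; lra|]. simpl pred.
    assert (H1 : (Cmod z ^ n <= r ^ n)%R) by (apply pow_incr; split; [apply Cmod_ge_0|lra]).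
    assert (H2 : (1 <= INR (S n))%R) by (rewrite S_INR; pose proof (pos_INR n); lra).
    pose proof (Cmod_ge_0 (a (S n))) as H3.
    pose proof (pow_le _ n (Cmod_ge_0 z)) as H4.
    replace (Cmod (a (S n)) * r ^ S n * INR (S n) ^ 2)%R
      with ((INR (S n) * Cmod (a (S n)) * r) * (r ^ n * INR (S n)))%R by (simpl; ring).
    replace (INR (S n) * Cmod (a (S n)) * Cmod z ^ n * r)%R
      with ((INR (S n) * Cmod (a (S n)) * r) * Cmod z ^ n)%R by ring.
    apply Rmult_le_compat_l; [|nra].
    apply Rmult_le_pos; [apply Rmult_le_pos; lra|lra].
  - exists ((2 * M * / (1 - / 2)) * / r)%R. apply is_series_scal_r. exact Hgeom. }
destruct El as [l Hl]. exists l. split.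
- apply (is_derive_quadratic_error _ _ _ (r - Cmod z) (2 * M * / (1 - / 2) * / r ^ 2)%R); [lra|].
  intros y Hy.
  assert (Hy' : (Cmod y <= r)%R).
  { pose proof (Cmod_triangle (y - z) z) as T. replace (y - z + z) with y in T by ring. lra. }
  assert (Hs : is_series (fun n => a n * (y ^ n - z ^ n - (y - z) * (INR n * z ^ pred n)))
     (power_sum a y - power_sum a z - (y - z) * l)).
  { pose proof (power_sum_correct R0 a y HR (ex_intro _ M HM) Hy') as Sy.
    pose proof (power_sum_correct R0 a z HR (ex_intro _ M HM) (Rlt_le _ _ Hz)) as Sz.
    pose proof (is_series_scal (V := C_NormedModule) (y - z) _ _ Hl) as Sl.
    pose proof (is_series_minus _ _ _ _ (is_series_minus _ _ _ _ Sy Sz) Sl) as S.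
    eapply is_series_ext; [|exact S].
    intros n. change ((a n * y ^ n + - (a n * z ^ n)) + - ((y - z) * (INR n * a n * z ^ pred n))
      = a n * (y ^ n - z ^ n - (y - z) * (INR n * z ^ pred n))). ring. }
  set (d := Cmod (y - z)).
  replace (2 * M * / (1 - / 2) * / r ^ 2 * d ^ 2)%R with (2 * M * / (1 - / 2) * (/ r ^ 2 * d ^ 2))%R by ring.
  refine (Cmod_series_le _ (fun n => 2 * M * (/ 2) ^ n * (/ r ^ 2 * d ^ 2))%R _ _ Hs _ _).
  + apply is_series_scal_r. exact Hgeom.
  + intros n. rewrite Cmod_mult.
    assert (Pr : (0 < r ^ 2)%R) by (apply pow_lt; exact Hr).
    apply (Rmult_le_reg_r (r ^ 2)); [exact Pr|].
    replace (2 * M * (/ 2) ^ n * (/ r ^ 2 * d ^ 2) * r ^ 2)%R with (2 * M * (/ 2) ^ n * d ^ 2)%R by (field; lra).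
    rewrite Rmult_assoc.
    eapply Rle_trans; [apply Rmult_le_compat_l; [apply Cmod_ge_0|apply (pow_first_order_error r); [exact Hr|exact Hy'|lra]]|].
    fold d.
    replace (Cmod (a n) * (INR n ^ 2 * r ^ n * d ^ 2))%R with (Cmod (a n) * r ^ n * INR n ^ 2 * d ^ 2)%R by ring.
    apply Rmult_le_compat_r; [apply pow2_ge_0|apply Hbase].
- eapply is_series_ext; [|exact (is_series_scal (V := C_NormedModule) z _ _ Hl)].
  intros n. change (z * (INR n * a n * z ^ pred n) = INR n * a n * z ^ n).
  destruct n as [|n]; simpl; ring.
Qed.

(** * A majorant for quadratic recursions *)

(** The squared inverse of [n], with value 0 at 0 because [/ 0 = 0]. *)
Definition weight (n : nat) : R := ((/ INR n) ^ 2)%R.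

Lemma weight_0 : weight 0 = 0%R.
Proof. unfold weight. simpl INR. rewrite Rinv_0. ring. Qed.

Lemma weight_ge_0 (n : nat) : (0 <= weight n)%R.
Proof. apply pow2_ge_0. Qed.

Lemma weight_S_gt_0 (n : nat) : (0 < weight (S n))%R.
Proof. apply pow_lt, Rinv_0_lt_compat, lt_0_INR. lia. Qed.

Lemma weight_le_1 (n : nat) : (weight n <= 1)%R.
Proof.
destruct n as [|n]; [rewrite weight_0; lra|].
unfold weight. replace 1%R with (1 ^ 2)%R by ring. apply pow_incr; split.
- apply Rlt_le, Rinv_0_lt_compat, lt_0_INR. lia.
- rewrite <- Rinv_1. apply Rinv_le_contravar; [lra|].
  rewrite S_INR. pose proof (pos_INR n). lra.
Qed.

(** Telescoping: [1 / (m + 1)^2 <= 1 / m - 1 / (m + 1)]. *)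
Lemma sum_weight_le (n : nat) : (sum_n weight n <= 2)%R.
Proof.
assert (H : forall m, (sum_n weight (S m) <= 2 - / INR (S m))%R).
{ induction m as [|m IH].
  - rewrite sum_Sn, sum_O, weight_0. unfold weight, plus; simpl. lra.
  - rewrite sum_Sn. change plus with Rplus.
    eapply Rle_trans; [apply Rplus_le_compat_r, IH|].
    unfold weight. rewrite (S_INR (S m)).
    assert (P : (0 < INR (S m))%R) by (apply lt_0_INR; lia).
    set (x := INR (S m)) in *.
    assert (E : (/ x - / (x + 1) - (/ (x + 1)) ^ 2 = / (x * (x + 1) ^ 2))%R) by (field; lra).
    assert (0 < / (x * (x + 1) ^ 2))%R.
    { apply Rinv_0_lt_compat, Rmult_lt_0_compat; [exact P|apply pow_lt; lra]. }
    lra. }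
destruct n as [|n].
- rewrite sum_O, weight_0. lra.
- specialize (H n). assert (0 < / INR (S n))%R by (apply Rinv_0_lt_compat, lt_0_INR; lia). lra.
Qed.

Lemma sum_n_rev (f : nat -> R) (n : nat) :
  sum_n (fun k => f (n - k)%nat) n = sum_n f n.
Proof.
revert f; induction n as [|n IH]; intros f.
- rewrite !sum_O. reflexivity.
- rewrite (sum_Sn f). rewrite <- IH.
  unfold sum_n at 1. rewrite sum_Sn_m by lia. rewrite plus_comm.
  f_equal. rewrite <- sum_n_m_S. reflexivity.
Qed.

(** With [x = k] and [y = n - k], [1 / (x y)] is [(1 / x + 1 / y) / (x + y)],
    and the square of a sum is at most twice the sum of the squares. *)
Lemma weight_product_le (n k : nat) :
  (k <= n)%nat ->
  (weight k * weight (n - k) <= 2 * weight n * (weight k + weight (n - k)))%R.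
Proof.
intros Hk.
pose proof (weight_ge_0 k) as Wk. pose proof (weight_ge_0 (n - k)) as Wm.
pose proof (weight_ge_0 n) as Wn.
destruct k as [|k]; [rewrite weight_0; nra|].
destruct (n - S k)%nat as [|m] eqn:Em; [rewrite weight_0; nra|].
replace n with (S k + S m)%nat by lia. unfold weight. rewrite plus_INR.
assert (Px : (0 < INR (S k))%R) by (apply lt_0_INR; lia).
assert (Py : (0 < INR (S m))%R) by (apply lt_0_INR; lia).
set (x := INR (S k)) in *. set (y := INR (S m)) in *.
assert (E : (2 * (/ (x + y)) ^ 2 * ((/ x) ^ 2 + (/ y) ^ 2) - (/ x) ^ 2 * (/ y) ^ 2
   = (x - y) ^ 2 * (/ (x * y * (x + y))) ^ 2)%R) by (field; lra).
assert (0 <= (x - y) ^ 2 * (/ (x * y * (x + y))) ^ 2)%R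
  by (apply Rmult_le_pos; apply pow2_ge_0).
lra.
Qed.

Lemma sum_n_le_loc (a b : nat -> R) (n : nat) :
  (forall k, (k <= n)%nat -> (a k <= b k)%R) -> (sum_n a n <= sum_n b n)%R.
Proof.
induction n as [|n IH]; intros H.
- rewrite !sum_O. apply H; lia.
- rewrite !sum_Sn. apply Rplus_le_compat; [apply IH; intros k Hk|]; apply H; lia.
Qed.

Lemma sum_n_Rmult_l (c : R) (a : nat -> R) (n : nat) :
  sum_n (fun k => c * a k)%R n = (c * sum_n a n)%R.
Proof. exact (sum_n_mult_l (K := R_Ring) c a n). Qed.

(** Up to a constant, [weight] is stable under convolution; this is what makes
    it usable as a majorant of a quadratic recursion. *)
Lemma weight_convolution_le (n : nat) :
  (sum_n (fun k => weight k * weight (n - k)) n <= 8 * weight n)%R.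
Proof.
eapply Rle_trans; [apply sum_n_le_loc; intros k Hk; apply weight_product_le, Hk|].
rewrite sum_n_Rmult_l.
assert (E : sum_n (fun k => weight k + weight (n - k))%R n
     = (sum_n weight n + sum_n weight n)%R).
{ rewrite <- (sum_n_rev weight n) at 2. exact (sum_n_plus weight (fun k => weight (n - k)) n). }
rewrite E. pose proof (sum_weight_le n). pose proof (weight_ge_0 n). nra.
Qed.

(** The bound proved by induction is [b n * R0 ^ n <= eps * weight n].  A small
    [R0] gives it for the finitely many [n < N]; for the others the convolution
    estimate reproduces it as soon as [8 K eps <= 1], hence the value of [eps]. *)
Lemma quadratic_majorant (b : nat -> R) (K : R) (N : nat) :
  (forall n, (0 <= b n)%R) -> b 0%nat = 0%R -> (0 <= K)%R ->
  (forall n, (N <= n)%nat -> (b n <= K * sum_n (fun k => b k * b (n - k)%nat)%R n)%R) ->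
  exists R0 : R, (0 < R0)%R /\ forall n, (b n * R0 ^ n <= 1)%R.
Proof.
intros Hb Hb0 HK Hrec.
set (eps := (/ (8 * K + 1))%R).
assert (Heps : (0 < eps)%R) by (apply Rinv_0_lt_compat; lra).
assert (Heps1 : (8 * K * eps + eps = 1)%R) by (unfold eps; field; lra).
assert (Hinit : exists R0 : R, (0 < R0 <= 1)%R /\
  forall n, (n < N)%nat -> (b n * R0 ^ n <= eps * weight n)%R).
{ clear Hrec. induction N as [|N [R1 [[P1 L1] H1]]].
  - exists 1%R. split; [lra|]. intros n Hn; lia.
  - destruct N as [|N].
    { exists 1%R. split; [lra|]. intros n Hn. replace n with 0%nat by lia.
      rewrite Hb0, weight_0. lra. }
    pose proof (weight_S_gt_0 N) as Hw. pose proof (Hb (S N)) as HbN.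
    set (q := (eps * weight (S N) / (b (S N) + 1))%R).
    assert (Hq : (0 < q)%R).
    { apply Rdiv_lt_0_compat; [apply Rmult_lt_0_compat; assumption|lra]. }
    assert (Hqb : (q * (b (S N) + 1) = eps * weight (S N))%R) by (unfold q; field; lra).
    exists (Rmin R1 q).
    assert (Pm : (0 < Rmin R1 q)%R) by (apply Rmin_glb_lt; assumption).
    pose proof (Rmin_l R1 q). pose proof (Rmin_r R1 q).
    split; [lra|]. intros n Hn.
    destruct (Nat.eq_dec n (S N)) as [->|Hne].
    + assert (Rmin R1 q ^ N <= 1)%R.
      { rewrite <- (pow1 N). apply pow_incr. lra. }
      assert (0 <= Rmin R1 q ^ N)%R by (apply pow_le; lra).
      assert (Rmin R1 q ^ S N <= q)%R by (simpl; nra).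
      nra.
    + eapply Rle_trans; [|apply H1; lia].
      apply Rmult_le_compat_l; [apply Hb|]. apply pow_incr. lra. }
destruct Hinit as [R0 [[P0 L0] H0]].
exists R0. split; [exact P0|].
assert (H : forall n, (b n * R0 ^ n <= eps * weight n)%R).
{ intros n. induction n as [n IH] using (well_founded_induction lt_wf).
  destruct (le_lt_dec N n) as [HN|HN]; [|apply H0, HN].
  assert (Hterm : forall k, (k <= n)%nat ->
    (R0 ^ n * (b k * b (n - k)%nat) <= eps ^ 2 * (weight k * weight (n - k)))%R).
  { intros k Hk.
    pose proof (weight_ge_0 k). pose proof (weight_ge_0 (n - k)).
    assert (0 <= eps ^ 2 * (weight k * weight (n - k)))%R.
    { apply Rmult_le_pos; [apply pow2_ge_0|apply Rmult_le_pos; assumption]. }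
    destruct (Nat.eq_dec k 0) as [->|Hk0]; [rewrite Hb0; lra|].
    destruct (Nat.eq_dec k n) as [->|Hkn].
    { rewrite Nat.sub_diag, Hb0. rewrite Nat.sub_diag in *. lra. }
    assert (E : (R0 ^ n = R0 ^ k * R0 ^ (n - k))%R) by (rewrite <- pow_add; f_equal; lia).
    rewrite E.
    replace (R0 ^ k * R0 ^ (n - k) * (b k * b (n - k)%nat))%R
      with ((b k * R0 ^ k) * (b (n - k)%nat * R0 ^ (n - k)))%R by ring.
    replace (eps ^ 2 * (weight k * weight (n - k)))%R
      with ((eps * weight k) * (eps * weight (n - k)))%R by ring.
    apply Rmult_le_compat; try (apply IH; lia);
      (apply Rmult_le_pos; [apply Hb|apply pow_le; lra]). }
  pose proof (sum_n_le_loc _ _ n Hterm) as S. rewrite !sum_n_Rmult_l in S.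
  pose proof (weight_convolution_le n) as W.
  pose proof (Hrec n HN) as Hn. pose proof (weight_ge_0 n).
  assert (Pn : (0 <= R0 ^ n)%R) by (apply pow_le; lra).
  set (s := sum_n (fun k => (b k * b (n - k)%nat)%R) n) in *.
  set (c := sum_n (fun k => (weight k * weight (n - k))%R) n) in *.
  assert (S1 : (b n * R0 ^ n <= K * (R0 ^ n * s))%R) by nra.
  assert (S2 : (K * (R0 ^ n * s) <= K * (eps ^ 2 * (8 * weight n)))%R).
  { apply Rmult_le_compat_l; [exact HK|]. eapply Rle_trans; [exact S|].
    apply Rmult_le_compat_l; [apply pow2_ge_0|exact W]. }
  assert (S3 : (K * (eps ^ 2 * (8 * weight n)) = (8 * K * eps) * (eps * weight n))%R) by ring.
  assert (0 <= eps * weight n)%R by (apply Rmult_le_pos; lra).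
  nra. }
intros n. eapply Rle_trans; [apply H|].
pose proof (weight_le_1 n). pose proof (weight_ge_0 n). nra.
Qed.

(** The table [tab m] is correct below [m], and the values just above these
    tables form the solution. *)
Lemma course_of_values (T : Type) (F : (nat -> T) -> nat -> T) :
  (forall X Y n, (forall k, (k < n)%nat -> X k = Y k) -> F X n = F Y n) -> inhabited T ->
  exists X : nat -> T, forall n, X n = F X n.
Proof.
intros HF [d].
set (tab := fix tab (m : nat) : nat -> T := match m with
  | O => fun _ => d
  | S m => fun k => if Nat.ltb k m then tab m k else F (tab m) m end).
assert (Htab : forall m k, (k < m)%nat -> tab m k = F (tab k) k).
{ induction m as [|m IH]; intros k Hk; [lia|]. simpl.
  destruct (Nat.ltb_spec k m) as [H|H]; [apply IH, H|].
  replace k with m by lia. reflexivity. }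
exists (fun n => F (tab n) n). intros n. apply HF.
intros k Hk. apply Htab, Hk.
Qed.

(** * Formal power series solutions *)

(** The coefficients of one power of [t - t0] in [(t - t0) v], [(t - t0) h],
    [(t - t0) y] and [(t - t0) q], where [q = v^2 / h]. *)
Record coeffs : Type := Coeffs { cv : C; ch : C; cy : C; cq : C }.

Definition coeffs0 : coeffs := Coeffs 0 0 0 0.

Definition size (x : coeffs) : R := (Cmod (cv x) + Cmod (ch x) + Cmod (cy x) + Cmod (cq x))%R.

Lemma Cmod_component_le (x : coeffs) :
  (Cmod (cv x) <= size x /\ Cmod (ch x) <= size x /\
   Cmod (cy x) <= size x /\ Cmod (cq x) <= size x)%R.
Proof.
unfold size. pose proof (Cmod_ge_0 (cv x)). pose proof (Cmod_ge_0 (ch x)).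
pose proof (Cmod_ge_0 (cy x)). pose proof (Cmod_ge_0 (cq x)). lra.
Qed.

Lemma size_ge_0 (x : coeffs) : (0 <= size x)%R.
Proof. eapply Rle_trans; [apply Cmod_ge_0|apply (Cmod_component_le x)]. Qed.

(** What splitting a convolution and bounding it need from the coordinate forms
    [cv], [ch], [cy], [cq]. *)
Definition component (p : coeffs -> C) : Prop :=
  p coeffs0 = 0 /\ forall x, (Cmod (p x) <= size x)%R.

Lemma component_cv : component cv.
Proof. split; [reflexivity|apply Cmod_component_le]. Qed.

Lemma component_ch : component ch.
Proof. split; [reflexivity|apply Cmod_component_le]. Qed.

Lemma component_cy : component cy.
Proof. split; [reflexivity|apply Cmod_component_le]. Qed.

Lemma component_cq : component cq.
Proof. split; [reflexivity|apply Cmod_component_le]. Qed.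

#[local] Hint Resolve component_cv component_ch component_cy component_cq : component.

(** Removing the constant term isolates, in a convolution of order [n], the part
    that involves only coefficients of order strictly between 0 and [n]. *)
Definition tail (X : nat -> coeffs) (n : nat) : coeffs :=
  match n with O => coeffs0 | S _ => X n end.

Definition conv (p q : coeffs -> C) (X : nat -> coeffs) : nat -> C :=
  Cauchy_product (fun k => p (X k)) (fun k => q (X k)).

Definition quad_v (X : nat -> coeffs) (n : nat) : C := (conv cv ch X n - conv cv cv X n) / 2.
Definition quad_h (X : nat -> coeffs) (n : nat) : C := - (conv ch ch X n + conv ch cy X n) / 2.
Definition quad_y (X : nat -> coeffs) (n : nat) : C :=
  27 / 2 * conv cv cv X n - 9 / 2 * conv cv ch X n - conv cv cy X n + 6 * conv cq cy X n.
Definition quad_q (X : nat -> coeffs) (n : nat) : C := conv cv cv X n - conv cq ch X n.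

(** The system of [ode_of_system] for the functions multiplied by [t - t0], in
    order [n].  The algebraic relation [q h = v^2] takes the place of a
    differential equation for [q] and keeps everything quadratic. *)
Definition solves (X : nat -> coeffs) (n : nat) : Prop :=
  INR n * cv (X n) = cv (X n) + quad_v X n /\
  INR n * ch (X n) = ch (X n) + quad_h X n /\
  INR n * cy (X n) = cy (X n) + quad_y X n /\
  quad_q X n = 0.

(** [solves] in order [n >= 1], as a linear system in the unknowns of order [n];
    [A], [B], [D], [E] collect the contributions of lower order. *)
Definition linearized (x0 : coeffs) (n : nat) (A B D E : C) (x : coeffs) : Prop :=
  let (v0, h0, y0, q0) := x0 in let (v, h, y, q) := x in
  INR n * v = v + (v0 * h + v * h0 - 2 * (v0 * v)) / 2 + A /\
  INR n * h = h - (2 * (h0 * h) + h0 * y + h * y0) / 2 + B /\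
  INR n * y = y + 27 * (v0 * v) - 9 / 2 * (v0 * h + v * h0) - (v0 * y + v * y0)
    + 6 * (q0 * y + q * y0) + D /\
  2 * (v0 * v) - (q0 * h + q * h0) + E = 0.

Lemma conv_split (p q : coeffs -> C) (X : nat -> coeffs) (n : nat) :
  component p -> component q -> (1 <= n)%nat ->
  conv p q X n = p (X 0%nat) * q (X n) + p (X n) * q (X 0%nat) + conv p q (tail X) n.
Proof.
intros [Hp _] [Hq _] Hn. destruct n as [|n]; [lia|].
unfold conv, Cauchy_product. rewrite !sum_Sn, Nat.sub_diag.
assert (H : forall j, (j <= n)%nat ->
  sum_n (fun k => p (X k) * q (X (S n - k)%nat)) j =
  p (X 0%nat) * q (X (S n)) + sum_n (fun k => p (tail X k) * q (tail X (S n - k)%nat)) j).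
{ induction j as [|j IH]; intros Hj.
  - rewrite !sum_O, Nat.sub_0_r. simpl. rewrite Hp. C_eq. ring.
  - rewrite !sum_Sn, IH by lia.
    replace (S n - S j)%nat with (S (n - S j)) by lia. simpl tail.
    change plus with Cplus. C_eq. ring. }
rewrite H by lia. simpl tail. rewrite Hq. change plus with Cplus. C_eq. ring.
Qed.

Lemma conv_ext (p q : coeffs -> C) (X Y : nat -> coeffs) (n : nat) :
  (forall k, (k <= n)%nat -> X k = Y k) -> conv p q X n = conv p q Y n.
Proof.
intros H. apply sum_n_ext_loc. intros k Hk. rewrite !H by lia. reflexivity.
Qed.

Lemma conv_tail_ext (p q : coeffs -> C) (X Y : nat -> coeffs) (n : nat) :
  component p -> component q -> (forall k, (k < n)%nat -> X k = Y k) ->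
  conv p q (tail X) n = conv p q (tail Y) n.
Proof.
intros [Hp _] [Hq _] H. apply sum_n_ext_loc. intros k Hk.
destruct (Nat.eq_dec k 0) as [->|Hk0]; [simpl; rewrite Hp; C_eq; ring|].
destruct (Nat.eq_dec k n) as [->|Hkn]; [rewrite Nat.sub_diag; simpl; rewrite Hq; C_eq; ring|].
destruct k as [|k]; [lia|]. destruct (n - S k)%nat as [|m] eqn:Em; [lia|].
simpl tail. rewrite !H by lia. reflexivity.
Qed.

Lemma solves_of_linearized (X : nat -> coeffs) (n : nat) :
  (1 <= n)%nat ->
  linearized (X 0%nat) n (quad_v (tail X) n) (quad_h (tail X) n) (quad_y (tail X) n)
    (quad_q (tail X) n) (X n) ->
  solves X n.
Proof.
intros Hn. unfold solves, quad_v, quad_h, quad_y, quad_q.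
rewrite !(fun p q => fun Hp Hq => conv_split p q X n Hp Hq Hn) by auto with component.
unfold linearized. destruct (X 0%nat) as [v0 h0 y0 q0], (X n) as [v h y q]; simpl cv; simpl ch; simpl cy; simpl cq.
intros [-> [-> [-> E]]]. split; [field|split;[field|split;[field|]]].
rewrite <- E. ring.
Qed.

Lemma Cmod_conv_le (p q : coeffs -> C) (X : nat -> coeffs) (n : nat) :
  component p -> component q ->
  (Cmod (conv p q X n) <= sum_n (fun k => size (X k) * size (X (n - k)%nat))%R n)%R.
Proof.
intros [_ Hp] [_ Hq]. apply Cmod_sum_n_le. intros k _. rewrite Cmod_mult.
apply Rmult_le_compat; try apply Cmod_ge_0; [apply Hp|apply Hq].
Qed.

Lemma Cmod_minus_le (x y : C) : (Cmod (x - y) <= Cmod x + Cmod y)%R.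
Proof. unfold Cminus. rewrite <- (Cmod_opp y). apply Cmod_triangle. Qed.

Lemma Cmod_real_mult (r : R) (x : C) : Cmod (r * x) = (Rabs r * Cmod x)%R.
Proof. rewrite Cmod_mult, Cmod_R. reflexivity. Qed.

Lemma quad_bound (X : nat -> coeffs) (n : nat) :
  (Cmod (quad_v X n) + Cmod (quad_h X n) + Cmod (quad_y X n) + Cmod (quad_q X n)
   <= 30 * sum_n (fun k => size (X k) * size (X (n - k)%nat))%R n)%R.
Proof.
set (S := sum_n _ n : R).
assert (B : forall p q, component p -> component q -> (Cmod (conv p q X n) <= S)%R)
  by (intros p q; apply Cmod_conv_le).
pose proof (B cv cv component_cv component_cv) as Bvv.
pose proof (B cv ch component_cv component_ch) as Bvh.
pose proof (B ch ch component_ch component_ch) as Bhh.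
pose proof (B ch cy component_ch component_cy) as Bhy.
pose proof (B cv cy component_cv component_cy) as Bvy.
pose proof (B cq cy component_cq component_cy) as Bqy.
pose proof (B cq ch component_cq component_ch) as Bqh.
unfold quad_v, quad_h, quad_y, quad_q.
replace ((conv cv ch X n - conv cv cv X n) / 2) with ((/ 2)%R * (conv cv ch X n - conv cv cv X n))
  by (rewrite RtoC_inv by lra; field).
replace (- (conv ch ch X n + conv ch cy X n) / 2) with ((- / 2)%R * (conv ch ch X n + conv ch cy X n))
  by (rewrite RtoC_opp, RtoC_inv by lra; field).
rewrite <- !RtoC_div by lra.
rewrite !Cmod_real_mult.
pose proof (Cmod_minus_le (conv cv ch X n) (conv cv cv X n)) as T1.
pose proof (Cmod_triangle (conv ch ch X n) (conv ch cy X n)) as T2.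
pose proof (Cmod_minus_le (conv cv cv X n) (conv cq ch X n)) as T3.
pose proof (Cmod_triangle ((27 / 2)%R * conv cv cv X n - (9 / 2)%R * conv cv ch X n - conv cv cy X n)
  (6 * conv cq cy X n)) as T4.
pose proof (Cmod_minus_le ((27 / 2)%R * conv cv cv X n - (9 / 2)%R * conv cv ch X n) (conv cv cy X n)) as T5.
pose proof (Cmod_minus_le ((27 / 2)%R * conv cv cv X n) ((9 / 2)%R * conv cv ch X n)) as T6.
rewrite !Cmod_real_mult in *.
rewrite Rabs_Ropp in *.
rewrite !(Rabs_pos_eq (/ 2)) in * by lra. rewrite !(Rabs_pos_eq (27 / 2)) in * by lra.
rewrite !(Rabs_pos_eq (9 / 2)) in * by lra. rewrite !(Rabs_pos_eq 6) in * by lra.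
pose proof (Cmod_ge_0 (conv cv cv X n)). lra.
Qed.

(** At the orders where the linear system of order [n] is singular the
    coefficients are prescribed through [init]; from order [N] on [sol] inverts
    it with a bound uniform in [n], so the recursion determines the other
    coefficients and [quadratic_majorant] applies to their sizes. *)
Theorem formal_solution (init : nat -> coeffs) (N : nat) (K : R)
    (sol : nat -> C -> C -> C -> C -> coeffs) :
  (1 <= N)%nat -> (0 <= K)%R ->
  (forall n, (n < N)%nat -> solves init n) ->
  (forall n A B D E, (N <= n)%nat ->
     linearized (init 0%nat) n A B D E (sol n A B D E) /\
     (size (sol n A B D E) <= K * (Cmod A + Cmod B + Cmod D + Cmod E))%R) ->
  exists X : nat -> coeffs,
    (forall n, (n < N)%nat -> X n = init n) /\
    (forall n, solves X n) /\
    exists R0 M : R, (0 < R0)%R /\ forall n, (size (X n) * R0 ^ n <= M)%R.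
Proof.
intros HN HK Hinit Hsol.
destruct (course_of_values coeffs (fun X n => if Nat.ltb n N then init n else
   sol n (quad_v (tail X) n) (quad_h (tail X) n) (quad_y (tail X) n) (quad_q (tail X) n)))
  as [X HX].
{ intros X Y n H. unfold quad_v, quad_h, quad_y, quad_q.
  rewrite !(fun p q => fun Hp Hq => conv_tail_ext p q X Y n Hp Hq H) by auto with component.
  reflexivity. }
{ exact (inhabits coeffs0). }
assert (Xlt : forall n, (n < N)%nat -> X n = init n).
{ intros n Hn. rewrite HX. destruct (Nat.ltb_spec n N); [reflexivity|lia]. }
assert (Xge : forall n, (N <= n)%nat -> X n =
   sol n (quad_v (tail X) n) (quad_h (tail X) n) (quad_y (tail X) n) (quad_q (tail X) n)).
{ intros n Hn. rewrite HX at 1. destruct (Nat.ltb_spec n N); [lia|reflexivity]. }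
exists X. split; [exact Xlt|]. split.
- intros n. destruct (le_lt_dec N n) as [Hn|Hn].
  + apply solves_of_linearized; [lia|]. rewrite (Xlt 0%nat) by lia. rewrite (Xge n Hn).
    apply Hsol, Hn.
  + specialize (Hinit n Hn).
    assert (Ext : forall k, (k <= n)%nat -> X k = init k) by (intros k Hk; apply Xlt; lia).
    unfold solves, quad_v, quad_h, quad_y, quad_q in *.
    rewrite !(fun p q => conv_ext p q X init n Ext), (Xlt n Hn). exact Hinit.
- destruct (quadratic_majorant (fun n => size (tail X n)) (K * 30) N) as [R0 [P0 H0]].
  + intros n. apply size_ge_0.
  + unfold size; simpl. rewrite Cmod_0. ring.
  + lra.
  + intros n Hn. destruct n as [|n]; [lia|]. simpl tail at 1.
    rewrite (Xge _ Hn). eapply Rle_trans; [apply Hsol, Hn|].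
    rewrite Rmult_assoc. apply Rmult_le_compat_l; [exact HK|]. apply quad_bound.
  + exists R0, (size (X 0%nat) + 1)%R. split; [exact P0|]. intros n.
    pose proof (size_ge_0 (X 0%nat)).
    destruct n as [|n]; [simpl; lra|]. specialize (H0 (S n)). simpl tail in H0. lra.
Qed.

(** * From coefficients to meromorphic solutions *)

Lemma is_series_first_term (a : nat -> C) :
  (forall n, a (S n) = 0) -> is_series a (a 0%nat).
Proof.
intros H. apply (filterlim_ext (fun _ => a 0%nat)); [|apply filterlim_const].
intros n; induction n as [|n IH]; [rewrite sum_O; reflexivity|].
rewrite sum_Sn, <- IH, H. change plus with Cplus. C_eq. ring.
Qed.

Lemma power_sum_0 (R0 : R) (a : nat -> C) :
  (0 < R0)%R -> geometric R0 a -> power_sum a 0 = a 0%nat.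
Proof.
intros HR Ha.
apply (is_series_C_unique (fun n => a n * 0 ^ n)).
- apply (power_sum_correct R0); [exact HR|exact Ha|]. rewrite Cmod_0. lra.
- replace (a 0%nat) with (a 0%nat * 0 ^ 0) by (simpl; ring).
  apply (is_series_first_term (fun n => a n * 0 ^ n)). intros n. simpl. ring.
Qed.

Lemma power_sum_nonzero (R0 : R) (a : nat -> C) :
  (0 < R0)%R -> geometric R0 a -> a 0%nat <> 0 ->
  exists r : R, (0 < r)%R /\ forall s, (Cmod s < r)%R -> power_sum a s <> 0.
Proof.
intros HR Ha H0.
destruct (is_derive_power_sum R0 a 0 HR Ha) as [l [Hl _]]; [rewrite Cmod_0; lra|].
assert (Hc : continuous (U := C_NormedModule) (power_sum a : C_AbsRing -> _) (RtoC 0)).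
{ apply ex_derive_continuous. exists l. exact Hl. }
assert (Hn : filterlim (fun s : C_AbsRing => Cmod (power_sum a s)) (locally (T := AbsRing_UniformSpace C_AbsRing) (RtoC 0))
   (locally (Cmod (power_sum a 0)))).
{ exact (filterlim_comp _ _ _ _ _ _ _ _ Hc (filterlim_norm (V := C_NormedModule) _)). }
rewrite (power_sum_0 R0) in Hn by assumption.
apply Cmod_gt_0 in H0.
destruct (Hn (fun x => (0 < x)%R)) as [e He].
{ exact (open_gt 0 _ H0). }
exists e. split; [apply cond_pos|]. intros s Hs. apply Cmod_gt_0.
apply He. change (Cmod (s - 0) < e)%R. replace (s - 0) with s by ring. exact Hs.
Qed.

Lemma Cdiv_neq_0 (x s : C) : x <> 0 -> s <> 0 -> x / s <> 0.
Proof.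
intros Hx Hs E. apply Hx. replace x with (x / s * s) by (field; exact Hs). rewrite E. ring.
Qed.

Lemma is_derive_shifted_quotient (F : C -> C) (t0 t l G : C) :
  t - t0 <> 0 -> is_derive F (t - t0) l -> (t - t0) * l = F (t - t0) + G ->
  is_derive (fun t => F (t - t0) / (t - t0)) t (G / (t - t0) ^ 2).
Proof.
intros Hs HF HG.
assert (Hsh : is_derive (fun t : C => t - t0) t (RtoC 1)).
{ eapply is_derive_C_eq; [apply is_derive_C_minus; [|apply is_derive_C_const]|].
  - apply is_derive_C_AbsRing, (is_derive_id (K := C_AbsRing)).
  - C_eq. change one with (RtoC 1). ring. }
eapply is_derive_C_eq.
- apply is_derive_C_mult.
  + apply (is_derive_C_comp F); [exact HF|exact Hsh].
  + apply (is_derive_C_comp (fun s : C => / s)); [apply is_derive_C_inv, Hs|exact Hsh].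
- replace G with ((t - t0) * l - F (t - t0)) by (rewrite HG; ring). C_eq. field. exact Hs.
Qed.

Lemma punctured_disc_open (t0 : C) (r : R) (t : C) :
  punctured_disc t0 r t ->
  exists e : R, (0 < e)%R /\ forall w, (Cmod (w - t) < e)%R -> punctured_disc t0 r w.
Proof.
intros [H1 H2]. set (d := Cmod (t - t0)) in *.
exists (Rmin d (r - d)). split; [apply Rmin_glb_lt; lra|]. intros w Hw.
pose proof (Rmin_l d (r - d)). pose proof (Rmin_r d (r - d)).
pose proof (Cmod_triangle (w - t) (t - t0)) as T1.
replace (w - t + (t - t0)) with (w - t0) in T1 by ring.
pose proof (Cmod_triangle (w - t0) (- (w - t))) as T2.
replace (w - t0 + - (w - t)) with (t - t0) in T2 by ring. rewrite Cmod_opp in T2.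
fold d in T1, T2. split; lra.
Qed.

(** The shift by one comes from the division by [t - t0]. *)
Definition laurent_coeff (X : nat -> coeffs) (k : Z) : C :=
  if Z.ltb k (-1) then 0 else cv (X (Z.to_nat (k + 1))).

Section Convergent.
Variables (X : nat -> coeffs) (R0 M : R) (t0 : C).
Hypothesis HR : (0 < R0)%R.
Hypothesis HM : forall n, (size (X n) * R0 ^ n <= M)%R.

Let psum (p : coeffs -> C) : C -> C := power_sum (fun n => p (X n)).

Lemma geometric_component (p : coeffs -> C) : component p ->
  geometric R0 (fun n => p (X n)).
Proof.
intros [_ Hp]. exists M. intros n. eapply Rle_trans; [|apply HM].
apply Rmult_le_compat_r; [apply pow_le; lra|apply Hp].
Qed.

Lemma laurent_expansion_quotient :
  laurent_expansion_at (fun t => psum cv (t - t0) / (t - t0)) t0 (laurent_coeff X).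
Proof.
exists (R0 / 4)%R. split; [lra|]. intros t [Ht1 Ht2].
set (s := t - t0) in *. assert (Hs : s <> 0) by (apply Cmod_gt_0; exact Ht1).
pose proof (power_sum_correct R0 _ s HR (geometric_component cv component_cv) (Rlt_le _ _ Ht2)) as S.
exists ((psum cv s - cv (X 0%nat)) / s), (cv (X 0%nat) / s). split; [|split].
- assert (S1 : is_series (fun n => cv (X (Datatypes.S n)) * s ^ Datatypes.S n) (psum cv s - cv (X 0%nat))).
  { apply (is_series_incr_1 (V := C_NormedModule) (fun n => cv (X n) * s ^ n)).
    replace (plus _ _) with (psum cv s : C_NormedModule); [exact S|].
    change plus with Cplus. C_eq. simpl. ring. }
  replace ((psum cv s - cv (X 0%nat)) / s) with (/ s * (psum cv s - cv (X 0%nat))) by (field; exact Hs).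
  eapply is_series_ext; [|exact (is_series_scal (V := C_NormedModule) (/ s) _ _ S1)].
  intros n. unfold laurent_coeff.
  destruct (Z.ltb_spec (Z.of_nat n) (-1)); [lia|].
  replace (Z.to_nat (Z.of_nat n + 1)) with (Datatypes.S n) by lia.
  change (/ s * (cv (X (Datatypes.S n)) * s ^ Datatypes.S n) = cv (X (Datatypes.S n)) * s ^ n).
  rewrite Cpow_S. field. exact Hs.
- replace (cv (X 0%nat) / s) with ((fun n => laurent_coeff X (- Z.of_nat (Datatypes.S n)) / s ^ Datatypes.S n) 0%nat).
  + apply is_series_first_term. intros n. unfold laurent_coeff.
    destruct (Z.ltb_spec (- Z.of_nat (Datatypes.S (Datatypes.S n))) (-1)); [|lia].
    unfold Cdiv. ring.
  + unfold laurent_coeff; simpl. change (Pos.to_nat 1) with 1%nat. field. exact Hs.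
- fold s. field. exact Hs.
Qed.

Hypothesis HX : forall n, solves X n.

(** [s l] has the coefficients [n p (X n)], and the recursion splits them. *)
Lemma psum_derive (p : coeffs -> C) (G : nat -> C) (g s : C) :
  component p -> (Cmod s < R0 / 4)%R ->
  (forall n, INR n * p (X n) = p (X n) + G n) -> is_series (fun n => G n * s ^ n) g ->
  exists l, is_derive (psum p) s l /\ s * l = psum p s + g.
Proof.
intros Hp Hs HG Sg.
destruct (is_derive_power_sum R0 _ s HR (geometric_component p Hp) Hs) as [l [Hl Sl]].
exists l. split; [exact Hl|].
apply (is_series_C_unique _ _ _ Sl).
pose proof (power_sum_correct R0 _ s HR (geometric_component p Hp) (Rlt_le _ _ Hs)) as Sp.
eapply is_series_ext; [|exact (is_series_plus _ _ _ _ Sp Sg)].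
intros n. simpl. rewrite HG. change plus with Cplus. C_eq. ring.
Qed.

Lemma is_series_conv (p q : coeffs -> C) (s : C) :
  component p -> component q ->
  (Cmod s < R0 / 4)%R ->
  is_series (fun n => conv p q X n * s ^ n) (psum p s * psum q s).
Proof.
intros Hp Hq Hs. apply (power_sum_mult R0); [exact HR|now apply geometric_component|now apply geometric_component|lra].
Qed.

Lemma is_series_combination (a b : nat -> C) (la lb x y s : C) :
  is_series (fun n => a n * s ^ n) la -> is_series (fun n => b n * s ^ n) lb ->
  is_series (fun n => (x * a n + y * b n) * s ^ n) (x * la + y * lb).
Proof.
intros Ha Hb.
eapply is_series_ext; [|exact (is_series_plus _ _ _ _ (is_series_scal (V := C_NormedModule) x _ _ Ha)
  (is_series_scal (V := C_NormedModule) y _ _ Hb))].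
intros n. change (x * (a n * s ^ n) + y * (b n * s ^ n) = (x * a n + y * b n) * s ^ n). ring.
Qed.

Lemma psum_system (s : C) : (Cmod s < R0 / 4)%R ->
  let V := psum cv s in let H := psum ch s in let Y := psum cy s in let Q := psum cq s in
  (exists l, is_derive (psum cv) s l /\ s * l = V + V * (H - V) / 2) /\
  (exists l, is_derive (psum ch) s l /\ s * l = H + - (H * (H + Y)) / 2) /\
  (exists l, is_derive (psum cy) s l /\
     s * l = Y + (27 / 2 * V ^ 2 - 9 / 2 * (V * H) - V * Y + 6 * (Q * Y))) /\
  V ^ 2 = Q * H.
Proof.
intros Hs V H Y Q.
assert (S : forall p q, component p -> component q ->
  is_series (fun n => conv p q X n * s ^ n) (psum p s * psum q s))
  by (intros p q Hp Hq; now apply is_series_conv).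
pose proof (S cv cv component_cv component_cv) as Svv.
pose proof (S cv ch component_cv component_ch) as Svh.
pose proof (S ch ch component_ch component_ch) as Shh.
pose proof (S ch cy component_ch component_cy) as Shy.
pose proof (S cv cy component_cv component_cy) as Svy.
pose proof (S cq cy component_cq component_cy) as Sqy.
pose proof (S cq ch component_cq component_ch) as Sqh.
split; [|split; [|split]].
- apply (psum_derive cv (quad_v X)); [apply component_cv|exact Hs|apply HX|].
  replace (V * (H - V) / 2) with (/ 2 * (V * H) + - / 2 * (V * V)) by field.
  eapply is_series_ext; [|exact (is_series_combination _ _ _ _ (/ 2) (- / 2) s Svh Svv)].
  intros n. unfold quad_v. C_eq. field.
- apply (psum_derive ch (quad_h X)); [apply component_ch|exact Hs|apply HX|].
  replace (- (H * (H + Y)) / 2) with (- / 2 * (H * H) + - / 2 * (H * Y)) by field.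
  eapply is_series_ext; [|exact (is_series_combination _ _ _ _ (- / 2) (- / 2) s Shh Shy)].
  intros n. unfold quad_h. C_eq. field.
- apply (psum_derive cy (quad_y X)); [apply component_cy|exact Hs|apply HX|].
  replace (27 / 2 * V ^ 2 - 9 / 2 * (V * H) - V * Y + 6 * (Q * Y))
    with (1 * (27 / 2 * (V * V) + - (9 / 2) * (V * H)) + 1 * (- (1) * (V * Y) + 6 * (Q * Y))) by field.
  eapply is_series_ext; [|exact (is_series_combination _ _ _ _ 1 1 s
     (is_series_combination _ _ _ _ (27 / 2) (- (9 / 2)) s Svv Svh)
     (is_series_combination _ _ _ _ (- (1)) 6 s Svy Sqy))].
  intros n. unfold quad_y. C_eq. field.
- assert (Z : 1 * (V * V) + - (1) * (Q * H) = 0).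
  { apply (is_series_C_unique _ _ _ (is_series_combination _ _ _ _ 1 (- (1)) s Svv Sqh)).
    assert (E : forall n, (1 * conv cv cv X n + - (1) * conv cq ch X n) * s ^ n = 0).
    { intros n. transitivity (quad_q X n * s ^ n); [unfold quad_q; ring|].
      destruct (HX n) as [_ [_ [_ ->]]]. ring. }
    replace (RtoC 0) with ((fun n => (1 * conv cv cv X n + - (1) * conv cq ch X n) * s ^ n) 0%nat) by apply E.
    apply is_series_first_term. intros n. apply E. }
  replace (V ^ 2) with (Q * H + (1 * (V * V) + - (1) * (Q * H))) by ring. rewrite Z. ring.
Qed.

(** Dividing the functions by [t - t0] turns the system for them into that of
    [ode_of_system]; the constant terms keep [v] and [h] away from zero near
    [t0]. *)
Lemma meromorphic_solution_quotient :
  cv (X 0%nat) <> 0 -> ch (X 0%nat) <> 0 ->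
  meromorphic_solution_near (fun t => psum cv (t - t0) / (t - t0)) t0.
Proof.
intros V0 H0. split.
- exists 1%nat, (R0 / 4)%R, (fun t => psum cv (t - t0)). split; [lra|]. split.
  + intros t Ht. destruct (psum_system _ Ht) as [[l [Hl _]] _].
    exists (1 * l). apply (is_derive_C_comp (psum cv) (fun t => t - t0)); [exact Hl|].
    eapply is_derive_C_eq; [apply is_derive_C_minus; [|apply is_derive_C_const]|].
    * apply is_derive_C_AbsRing, (is_derive_id (K := C_AbsRing)).
    * C_eq. change one with (RtoC 1). ring.
  + intros t [Ht _]. apply Cmod_gt_0 in Ht. rewrite Cpow_1_r. reflexivity.
- destruct (power_sum_nonzero R0 _ HR (geometric_component cv component_cv) V0) as [r1 [P1 N1]].
  destruct (power_sum_nonzero R0 _ HR (geometric_component ch component_ch) H0) as [r2 [P2 N2]].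
  set (r := Rmin (R0 / 4) (Rmin r1 r2)).
  assert (Pr : (0 < r)%R) by (repeat apply Rmin_glb_lt; lra).
  assert (L0 : (r <= R0 / 4)%R) by apply Rmin_l.
  assert (L1 : (r <= r1)%R) by (eapply Rle_trans; [apply Rmin_r|apply Rmin_l]).
  assert (L2 : (r <= r2)%R) by (eapply Rle_trans; [apply Rmin_r|apply Rmin_r]).
  exists r. split; [exact Pr|].
  assert (Hd : forall t, punctured_disc t0 r t -> t - t0 <> 0 /\ (Cmod (t - t0) < R0 / 4)%R).
  { intros t [Ht1 Ht2]. split; [apply Cmod_gt_0; exact Ht1|lra]. }
  apply (ode_of_system (punctured_disc t0 r) _ (fun t => psum ch (t - t0) / (t - t0))
    (fun t => psum cy (t - t0) / (t - t0))).
  + apply punctured_disc_open.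
  + intros t Ht. destruct (Hd t Ht) as [Hs _]. destruct Ht as [_ Ht].
    split; (apply Cdiv_neq_0; [|exact Hs]); [apply N1|apply N2]; lra.
  + intros t Ht. destruct (Hd t Ht) as [Hs Hr].
    destruct (psum_system _ Hr) as [[l [Hl E]] _].
    eapply is_derive_C_eq; [exact (is_derive_shifted_quotient (psum cv) t0 t l _ Hs Hl E)|].
    field. exact Hs.
  + intros t Ht. destruct (Hd t Ht) as [Hs Hr].
    destruct (psum_system _ Hr) as [_ [[l [Hl E]] _]].
    eapply is_derive_C_eq; [exact (is_derive_shifted_quotient (psum ch) t0 t l _ Hs Hl E)|].
    field. exact Hs.
  + intros t Ht. destruct (Hd t Ht) as [Hs Hr].
    destruct (psum_system _ Hr) as [_ [_ [[l [Hl E]] EQ]]].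
    assert (Hh : psum ch (t - t0) <> 0) by (apply N2; destruct Ht; lra).
    eapply is_derive_C_eq; [exact (is_derive_shifted_quotient (psum cy) t0 t l _ Hs Hl E)|].
    replace (psum cq (t - t0)) with (psum cv (t - t0) ^ 2 / psum ch (t - t0)) by (rewrite EQ; field; exact Hh).
    field. split; assumption.
Qed.
End Convergent.

(** * Inverting the linear system of order n *)

Lemma Rabs_div_le (u p x k : R) :
  (0 < p)%R -> (x * Rabs u <= k * p)%R -> (x * Rabs (u / p) <= k)%R.
Proof.
intros Hp H. unfold Rdiv. rewrite Rabs_mult, (Rabs_pos_eq (/ p)) by (apply Rlt_le, Rinv_0_lt_compat, Hp).
apply (Rmult_le_reg_r p); [exact Hp|].
replace (x * (Rabs u * / p) * p)%R with (x * Rabs u)%R by (field; lra). exact H.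
Qed.

Lemma Cmod_comb3_le (x k a b c : R) (u v w : C) :
  (0 <= x)%R -> (x * Rabs a <= k)%R -> (x * Rabs b <= k)%R -> (x * Rabs c <= k)%R ->
  (x * Cmod (a * u + b * v + c * w) <= k * (Cmod u + Cmod v + Cmod w))%R.
Proof.
intros Hx Ha Hb Hc.
pose proof (Cmod_triangle (a * u + b * v) (c * w)) as T1.
pose proof (Cmod_triangle (a * u) (b * v)) as T2.
rewrite !Cmod_real_mult in T1. rewrite !Cmod_real_mult in T2.
pose proof (Cmod_ge_0 u). pose proof (Cmod_ge_0 v). pose proof (Cmod_ge_0 w).
assert (x * Rabs a * Cmod u <= k * Cmod u)%R by (apply Rmult_le_compat_r; assumption).
assert (x * Rabs b * Cmod v <= k * Cmod v)%R by (apply Rmult_le_compat_r; assumption).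
assert (x * Rabs c * Cmod w <= k * Cmod w)%R by (apply Rmult_le_compat_r; assumption).
apply Rle_trans with (x * (Rabs a * Cmod u + Rabs b * Cmod v + Rabs c * Cmod w))%R.
- apply Rmult_le_compat_l; lra.
- lra.
Qed.

Lemma RtoC_neq_0 (x : R) : x <> 0%R -> RtoC x <> 0.
Proof. intros H E. apply H, (f_equal Re E). Qed.

(** The constant terms for residue [-1]: the recursion of order 0 with
    [v = - 1] forces the other three. *)
Definition base_residue_m1 : coeffs := Coeffs (- 1) (- 3) 5 (- 1 / 3).

(** Solves the linear system of order [n] around [base_residue_m1] by elimination in
    favour of [v].  The determinant [p] vanishes exactly at the orders -1, 1 and
    2; the last two carry the free parameters. *)
Definition solve_residue_m1 (n : nat) (A B D E : C) : coeffs :=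
  let x := INR n in
  let p := ((x - 1) * (x + 1) * (x - 2))%R in
  let F := D - 10 * E in
  let v := (- (3 / 4) / p)%R * F + (- (x / 2) / p)%R * B
           + ((x * (x - 3 / 2) - 7 / 4) / p)%R * A in
  let h := (1 - 2 * x)%R * v + 2 * A in
  let y := (2 / 3 * x - 1)%R * h - 2 / 3 * B in
  Coeffs v h y ((2 * v - h / 3 - E) / 3).

Lemma solve_residue_m1_correct (n : nat) (A B D E : C) : (3 <= n)%nat ->
  linearized base_residue_m1 n A B D E (solve_residue_m1 n A B D E).
Proof.
intros Hn. assert (Hx : (3 <= INR n)%R) by (apply (le_INR 3) in Hn; simpl in Hn; lra).
assert (N1 : RtoC (INR n) - 1 <> 0) by (rewrite <- RtoC_minus; apply RtoC_neq_0; lra).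
assert (N2 : RtoC (INR n) + 1 <> 0) by (rewrite <- RtoC_plus; apply RtoC_neq_0; lra).
assert (N3 : RtoC (INR n) - 2 <> 0) by (rewrite <- RtoC_minus; apply RtoC_neq_0; lra).
assert (Np : ((INR n - 1) * (INR n + 1) * (INR n - 2))%R <> 0%R).
{ repeat apply Rmult_integral_contrapositive_currified; lra. }
unfold linearized, base_residue_m1, solve_residue_m1.
rewrite !RtoC_div by assumption.
repeat (rewrite RtoC_mult || rewrite RtoC_plus || rewrite RtoC_minus || rewrite RtoC_opp || rewrite RtoC_div by lra).
generalize dependent (RtoC (INR n)); intros x N1 N2 N3.
split; [field; tauto|split; [field; tauto|split; field; tauto]].
Qed.

(** For bounded data [v] is of size [1 / n] and [h] of size 1, but the formula for [y] loses a
    factor [n]; the bound for [y] is read off the third equation instead. *)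
Lemma solve_residue_m1_size (n : nat) (A B D E : C) : (4 <= n)%nat ->
  (size (solve_residue_m1 n A B D E) <= 200 * (Cmod A + Cmod B + Cmod D + Cmod E))%R.
Proof.
intros Hn. assert (Hx : (4 <= INR n)%R) by (apply (le_INR 4) in Hn; simpl in Hn; lra).
destruct (solve_residue_m1_correct n A B D E ltac:(lia)) as [_ [_ [Hy _]]].
revert Hy. unfold solve_residue_m1, size; simpl cv; simpl ch; simpl cy; simpl cq.
set (x := INR n) in *. set (p := ((x - 1) * (x + 1) * (x - 2))%R).
set (F := D - 10 * E).
set (v := (- (3 / 4) / p)%R * F + _ + _). set (h := _ * v + 2 * A).
set (y := _ * h - _). set (q := (2 * v - _ - E) / 3). intros Hy.
pose proof (Cmod_ge_0 A). pose proof (Cmod_ge_0 B). pose proof (Cmod_ge_0 D). pose proof (Cmod_ge_0 E).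
assert (Pp : (0 < p)%R) by (unfold p; nra).
assert (HF : (Cmod F <= Cmod D + 10 * Cmod E)%R).
{ unfold F. eapply Rle_trans; [apply Cmod_minus_le|]. rewrite Cmod_real_mult, Rabs_pos_eq; lra. }
assert (Hv : (x * Cmod v <= 2 * (Cmod F + Cmod B + Cmod A))%R).
{ apply Cmod_comb3_le; [lra| | |]; apply Rabs_div_le; try exact Pp; unfold p.
  - rewrite Rabs_Ropp, Rabs_pos_eq by lra. nra.
  - rewrite Rabs_Ropp, Rabs_pos_eq by lra. nra.
  - rewrite Rabs_pos_eq by nra. nra. }
set (T := (Cmod A + Cmod B + Cmod D + Cmod E)%R).
assert (Hv' : (x * Cmod v <= 20 * T)%R) by (unfold T; lra).
pose proof (Cmod_ge_0 v).
assert (Hv2 : (Cmod v <= 5 * T)%R) by nra.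
assert (Hh : (Cmod h <= 42 * T)%R).
{ unfold h. eapply Rle_trans; [apply Cmod_triangle|]. rewrite !Cmod_real_mult.
  rewrite (Rabs_left1 (1 - 2 * x)), (Rabs_pos_eq 2) by lra.
  assert (Cmod A <= T)%R by (unfold T; lra). lra. }
assert (Ey : x * y = (3 / 2)%R * v + (7 / 6)%R * h + F).
{ rewrite Hy. unfold q, F. rewrite !RtoC_div by lra. field. }
assert (HyT : (Cmod y <= 70 * T)%R).
{ pose proof (Cmod_triangle ((3 / 2)%R * v + (7 / 6)%R * h) F) as T1.
  pose proof (Cmod_triangle ((3 / 2)%R * v) ((7 / 6)%R * h)) as T2.
  rewrite <- Ey in T1. rewrite !Cmod_real_mult in T1. rewrite !Cmod_real_mult in T2.
  rewrite (Rabs_pos_eq x) in T1 by lra. rewrite !Rabs_pos_eq in T2 by lra.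
  pose proof (Cmod_ge_0 y). assert (Cmod F <= 10 * T)%R by (unfold T; lra).
  assert (x * Cmod y <= 70 * T)%R by lra. nra. }
assert (HqT : (Cmod q <= 20 * T)%R).
{ assert (Eq : q = (2 / 3)%R * v - (1 / 9)%R * h - (1 / 3)%R * E)
    by (unfold q; rewrite !RtoC_div by lra; field).
  rewrite Eq.
  pose proof (Cmod_minus_le ((2 / 3)%R * v - (1 / 9)%R * h) ((1 / 3)%R * E)) as T1.
  pose proof (Cmod_minus_le ((2 / 3)%R * v) ((1 / 9)%R * h)) as T2.
  rewrite !Cmod_real_mult in T1. rewrite !Cmod_real_mult in T2. rewrite !Rabs_pos_eq in T1 by lra. rewrite !Rabs_pos_eq in T2 by lra.
  assert (Cmod E <= T)%R by (unfold T; lra). lra. }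
lra.
Qed.

(** The constant terms for residue [-2], forced in the same way. *)
Definition base_residue_m2 : coeffs := Coeffs (- 2) (- 4) 6 (- (1)).

(** Same elimination around [base_residue_m2]; here the determinant vanishes at the
    orders -2, -1 and 3. *)
Definition solve_residue_m2 (n : nat) (A B D E : C) : coeffs :=
  let x := INR n in
  let p := ((x - 3) * (x + 1) * (x + 2))%R in
  let F := D - 9 * E in
  let v := (- 2 / p)%R * F + (- (x + 3) / p)%R * B + ((x + 3) * (x - 2) / p)%R * A in
  let h := (1 - x)%R * v + A in
  let y := ((x - 2) / 2)%R * h - / 2 * B in
  Coeffs v h y (v - h / 4 - E / 4).

Lemma solve_residue_m2_correct (n : nat) (A B D E : C) : (4 <= n)%nat ->
  linearized base_residue_m2 n A B D E (solve_residue_m2 n A B D E).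
Proof.
intros Hn. assert (Hx : (4 <= INR n)%R) by (apply (le_INR 4) in Hn; simpl in Hn; lra).
assert (N1 : RtoC (INR n) - 3 <> 0) by (rewrite <- RtoC_minus; apply RtoC_neq_0; lra).
assert (N2 : RtoC (INR n) + 1 <> 0) by (rewrite <- RtoC_plus; apply RtoC_neq_0; lra).
assert (N3 : RtoC (INR n) + 2 <> 0) by (rewrite <- RtoC_plus; apply RtoC_neq_0; lra).
assert (Np : ((INR n - 3) * (INR n + 1) * (INR n + 2))%R <> 0%R).
{ repeat apply Rmult_integral_contrapositive_currified; lra. }
unfold linearized, base_residue_m2, solve_residue_m2.
rewrite !RtoC_div by (assumption || lra).
repeat (rewrite RtoC_mult || rewrite RtoC_plus || rewrite RtoC_minus || rewrite RtoC_opp).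
generalize dependent (RtoC (INR n)); intros x N1 N2 N3.
split; [field; tauto|split; [field; tauto|split; field; tauto]].
Qed.

Lemma solve_residue_m2_size (n : nat) (A B D E : C) : (7 <= n)%nat ->
  (size (solve_residue_m2 n A B D E) <= 200 * (Cmod A + Cmod B + Cmod D + Cmod E))%R.
Proof.
intros Hn. assert (Hx : (7 <= INR n)%R) by (apply (le_INR 7) in Hn; simpl in Hn; lra).
destruct (solve_residue_m2_correct n A B D E ltac:(lia)) as [_ [_ [Hy _]]].
revert Hy. unfold solve_residue_m2, size; simpl cv; simpl ch; simpl cy; simpl cq.
set (x := INR n) in *. set (p := ((x - 3) * (x + 1) * (x + 2))%R).
set (F := D - 9 * E).
set (v := (- 2 / p)%R * F + _ + _). set (h := _ * v + A).
set (y := _ * h - _). set (q := v - _ - E / 4). intros Hy.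
pose proof (Cmod_ge_0 A). pose proof (Cmod_ge_0 B). pose proof (Cmod_ge_0 D). pose proof (Cmod_ge_0 E).
assert (Pp : (0 < p)%R) by (unfold p; nra).
assert (HF : (Cmod F <= Cmod D + 9 * Cmod E)%R).
{ unfold F. eapply Rle_trans; [apply Cmod_minus_le|]. rewrite Cmod_real_mult, Rabs_pos_eq; lra. }
assert (Hv : (x * Cmod v <= 2 * (Cmod F + Cmod B + Cmod A))%R).
{ apply Cmod_comb3_le; [lra| | |]; apply Rabs_div_le; try exact Pp; unfold p.
  - rewrite Rabs_left1 by lra. nra.
  - rewrite Rabs_left1 by lra. nra.
  - rewrite Rabs_pos_eq by nra.
    assert (0 <= x ^ 2 * (x - 7))%R by (apply Rmult_le_pos; [apply pow2_ge_0|lra]). nra. }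
set (T := (Cmod A + Cmod B + Cmod D + Cmod E)%R).
assert (Hv' : (x * Cmod v <= 20 * T)%R) by (unfold T; lra).
pose proof (Cmod_ge_0 v).
assert (Hv2 : (Cmod v <= 3 * T)%R) by nra.
assert (Hh : (Cmod h <= 21 * T)%R).
{ unfold h. eapply Rle_trans; [apply Cmod_triangle|]. rewrite !Cmod_real_mult.
  rewrite (Rabs_left1 (1 - x)) by lra.
  assert (Cmod A <= T)%R by (unfold T; lra). lra. }
assert (Ey : (x + 3)%R * y = F - 6 * v).
{ assert (E1 : (x + 3)%R * y = x * y + 3 * y) by (rewrite RtoC_plus; ring).
  rewrite E1, Hy. unfold q, F. field. }
assert (HyT : (Cmod y <= 28 * T)%R).
{ pose proof (Cmod_minus_le F (6 * v)) as T1.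
  rewrite <- Ey in T1. rewrite !Cmod_real_mult in T1.
  rewrite !Rabs_pos_eq in T1 by lra.
  pose proof (Cmod_ge_0 y). assert (Cmod F <= 10 * T)%R by (unfold T; lra).
  assert ((x + 3) * Cmod y <= 28 * T)%R by lra. nra. }
assert (HqT : (Cmod q <= 20 * T)%R).
{ assert (Eq : q = v - (1 / 4)%R * h - (1 / 4)%R * E)
    by (unfold q; rewrite !RtoC_div by lra; field).
  rewrite Eq.
  pose proof (Cmod_minus_le (v - (1 / 4)%R * h) ((1 / 4)%R * E)) as T1.
  pose proof (Cmod_minus_le v ((1 / 4)%R * h)) as T2.
  rewrite !Cmod_real_mult in T1. rewrite !Cmod_real_mult in T2. rewrite !Rabs_pos_eq in T1 by lra. rewrite !Rabs_pos_eq in T2 by lra.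
  assert (Cmod E <= T)%R by (unfold T; lra). lra. }
lra.
Qed.

(** * The first coefficients *)

(** At the orders 1 and 2 the system is singular but consistent, which leaves
    [a] and [b] free.  Order 3 is listed because its coefficient appears in the
    displayed expansion. *)
Definition init_residue_m1 (a b : C) (n : nat) : coeffs :=
  match n with
  | 0%nat => base_residue_m1
  | 1%nat => Coeffs a (- a) (a / 3) (7 / 9 * a)
  | 2%nat => Coeffs b (- 3 * b - 2 * a ^ 2) (- b - 4 / 9 * a ^ 2) (b - 10 / 27 * a ^ 2)
  | 3%nat => Coeffs (a * (a ^ 2 + b) / 2) (- (9 / 2) * a ^ 3 - 17 / 2 * (a * b))
          (- (175 / 54) * a ^ 3 - 13 / 2 * (a * b)) (71 / 162 * a ^ 3 - / 2 * (a * b))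
  | _ => coeffs0
  end.

(** The only free coefficient is that of order 3.  The orders up to 6 are listed
    because the displayed expansion reaches that far. *)
Definition init_residue_m2 (a : C) (n : nat) : coeffs :=
  match n with
  | 0%nat => base_residue_m2
  | 3%nat => Coeffs a (- 2 * a) (- a) (3 / 2 * a)
  | 6%nat => Coeffs (2 / 21 * a ^ 2) (- (83 / 42) * a ^ 2) (- (103 / 42) * a ^ 2) (- (23 / 56) * a ^ 2)
  | _ => coeffs0
  end.

Ltac check_coefficients :=
  unfold solves, quad_v, quad_h, quad_y, quad_q, conv, Cauchy_product;
  rewrite !sum_Sn, !sum_O, INR_IZR_INZ; cbn -[RtoC Cplus Cmult Cminus Copp Cdiv Cinv Cpow];
  change plus with Cplus; repeat split; C_eq; field.

Lemma init_residue_m1_solves (a b : C) (n : nat) : (n < 4)%nat -> solves (init_residue_m1 a b) n.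
Proof.
intros Hn. destruct n as [|[|[|[|n]]]]; [| | | |lia].
- unfold solves, quad_v, quad_h, quad_y, quad_q, conv, Cauchy_product.
  rewrite !sum_O. cbn -[RtoC Cplus Cmult Cminus Copp Cdiv Cinv Cpow].
  repeat split; C_eq; field.
- check_coefficients.
- check_coefficients.
- check_coefficients.
Qed.

Lemma init_residue_m2_solves (a : C) (n : nat) : (n < 7)%nat -> solves (init_residue_m2 a) n.
Proof.
intros Hn. destruct n as [|[|[|[|[|[|[|n]]]]]]]; [| | | | | | |lia].
- unfold solves, quad_v, quad_h, quad_y, quad_q, conv, Cauchy_product.
  rewrite !sum_O. cbn -[RtoC Cplus Cmult Cminus Copp Cdiv Cinv Cpow].
  repeat split; C_eq; field.
- check_coefficients.
- check_coefficients.
- check_coefficients.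
- check_coefficients.
- check_coefficients.
- check_coefficients.
Qed.

(** * The three families *)

Lemma solution_with_coefficients (t0 : C) (init : nat -> coeffs) (N : nat) (K : R)
    (sol : nat -> C -> C -> C -> C -> coeffs) :
  (1 <= N)%nat -> (0 <= K)%R ->
  (forall n, (n < N)%nat -> solves init n) ->
  (forall n A B D E, (N <= n)%nat ->
     linearized (init 0%nat) n A B D E (sol n A B D E) /\
     (size (sol n A B D E) <= K * (Cmod A + Cmod B + Cmod D + Cmod E))%R) ->
  cv (init 0%nat) <> 0 -> ch (init 0%nat) <> 0 ->
  exists (v : C -> C) (c : Z -> C),
    meromorphic_solution_near v t0 /\
    laurent_expansion_at v t0 c /\
    (forall k : Z, (k < -1)%Z -> c k = 0) /\
    (forall n : nat, (n < N)%nat -> c (Z.of_nat n - 1)%Z = cv (init n)).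
Proof.
intros HN HK Hinit Hsol Hv Hh.
destruct (formal_solution init N K sol HN HK Hinit Hsol) as [X [HX [HS [R0 [M [HR HM]]]]]].
exists (fun t => power_sum (fun n => cv (X n)) (t - t0) / (t - t0)), (laurent_coeff X).
split; [|split; [|split]].
- apply (meromorphic_solution_quotient X R0 M t0 HR HM HS); rewrite HX by lia; assumption.
- apply (laurent_expansion_quotient X R0 M t0 HR HM).
- intros k Hk. unfold laurent_coeff. destruct (Z.ltb_spec k (-1)); [reflexivity|lia].
- intros n Hn. unfold laurent_coeff. destruct (Z.ltb_spec (Z.of_nat n - 1) (-1)); [lia|].
  rewrite <- HX by exact Hn. do 2 f_equal. lia.
Qed.

(** For [v = 1 / (t - t0)] the other two functions are [h = - 1 / (t - t0)] and
    [y = 3 / (t - t0)]. *)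
Lemma inverse_solution (t0 : C) :
  meromorphic_solution_near (fun t : C => 1 / (t - t0)) t0.
Proof.
assert (Hd : forall c t : C, t - t0 <> 0 ->
  is_derive (fun t => c / (t - t0)) t (- c / (t - t0) ^ 2)).
{ intros c t Ht. apply (is_derive_shifted_quotient (fun _ => c) t0 t 0 (- c) Ht).
  - apply is_derive_C_const.
  - ring. }
split.
- exists 1%nat, 1%R, (fun _ => RtoC 1). split; [lra|]. split.
  + intros t _. exists (RtoC 0). apply is_derive_C_const.
  + intros t _. rewrite Cpow_1_r. reflexivity.
- exists 1%R. split; [lra|].
  apply (ode_of_system (punctured_disc t0 1) _ (fun t => - (1) / (t - t0)) (fun t => 3 / (t - t0)));
    [apply punctured_disc_open| | | |];
    intros t [Ht _]; apply Cmod_gt_0 in Ht.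
  + split; (apply Cdiv_neq_0; [|exact Ht]); [|rewrite <- RtoC_opp]; apply RtoC_neq_0; lra.
  + eapply is_derive_C_eq; [apply Hd, Ht|]. field. exact Ht.
  + eapply is_derive_C_eq; [apply Hd, Ht|]. field. exact Ht.
  + eapply is_derive_C_eq; [apply Hd, Ht|]. field. exact Ht.
Qed.

Theorem mainTheorem2 (t0 : C) :
  (forall a1 a2 : C, exists (v : C -> C) (c : Z -> C),
      meromorphic_solution_near v t0 /\
      laurent_expansion_at v t0 c /\
      (forall k : Z, (k < -1)%Z -> c k = 0) /\
      c (-1)%Z = - 1 /\
      c 0%Z = a1 /\
      c 1%Z = a2 /\
      c 2%Z = a1 * (a1 ^ 2 + a2) / 2)
  /\
  (forall a1 : C, exists (v : C -> C) (c : Z -> C),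
      meromorphic_solution_near v t0 /\
      laurent_expansion_at v t0 c /\
      (forall k : Z, (k < 5)%Z -> k <> (-1)%Z -> k <> 2%Z -> c k = 0) /\
      c (-1)%Z = - 2 /\
      c 2%Z = a1 /\
      c 5%Z = 2 / 21 * a1 ^ 2)
  /\
  meromorphic_solution_near (fun t : C => 1 / (t - t0)) t0.
Proof.
split; [|split; [|apply inverse_solution]].
- intros a1 a2.
  destruct (solution_with_coefficients t0 (init_residue_m1 a1 a2) 4 200 solve_residue_m1)
    as [v [c [Hv [Hc [Hneg Hk]]]]].
  + lia.
  + lra.
  + intros n Hn. now apply init_residue_m1_solves.
  + intros n A B D E Hn. split; [apply solve_residue_m1_correct; lia|now apply solve_residue_m1_size].
  + intros E. apply (f_equal Re) in E. simpl in E. lra.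
  + intros E. apply (f_equal Re) in E. simpl in E. lra.
  + exists v, c. split; [exact Hv|]. split; [exact Hc|]. split; [exact Hneg|].
    split; [apply (Hk 0%nat)|split; [apply (Hk 1%nat)|split; [apply (Hk 2%nat)|apply (Hk 3%nat)]]]; lia.
- intros a1.
  destruct (solution_with_coefficients t0 (init_residue_m2 a1) 7 200 solve_residue_m2)
    as [v [c [Hv [Hc [Hneg Hk]]]]].
  + lia.
  + lra.
  + intros n Hn. now apply init_residue_m2_solves.
  + intros n A B D E Hn. split; [apply solve_residue_m2_correct; lia|now apply solve_residue_m2_size].
  + intros E. apply (f_equal Re) in E. simpl in E. lra.
  + intros E. apply (f_equal Re) in E. simpl in E. lra.
  + exists v, c. split; [exact Hv|]. split; [exact Hc|]. split.
    * intros k Hk5 Hk1 Hk2. destruct (Z.lt_ge_cases k (-1)) as [Hlt|Hge]; [now apply Hneg|].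
      assert (Ck : (k = 0 \/ k = 1 \/ k = 3 \/ k = 4)%Z) by lia.
      destruct Ck as [-> | [-> | [-> | ->]]];
        [apply (Hk 1%nat)|apply (Hk 2%nat)|apply (Hk 4%nat)|apply (Hk 5%nat)]; lia.
    * split; [apply (Hk 0%nat)|split; [apply (Hk 3%nat)|apply (Hk 6%nat)]]; lia.
Qed.
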